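(* Let $R$ be an iterated local skew power series ring in the ordered list of variables $x_1,\dots,x_n$ of type $(A_\triangle)$ or $(B_\triangle)$ (i.e. all skew derivations are local, $A$-linear and triangular), and let $\preceq$ be any triangular additive total order on $\mathbb{N}^n$. Then $\mathrm{LM}_\preceq(x^\alpha x^\beta)=\alpha+\beta$ for all $\alpha,\beta\in\mathbb{N}^n$; in particular, $\preceq$ is a monomial order on $R$.
   Context: $\mathbb{N}$ contains $0$. A skew derivation on a ring $B$ is a pair $(\sigma,\delta)$ with $\sigma$ an automorphism of $B$ and $\delta:B\to B$ additive with $\delta(rs)=\delta(r)s+\sigma(r)\delta(s)$. If $(B,\mathfrak m)$ is a complete local ring, $(\sigma,\delta)$ is local if $\sigma(\mathfrak m^i)=\mathfrak m^i$ and $\delta(\mathfrak m^i)\subseteq\mathfrak m^{i+1}$ for all $i\ge 0$; then the skew power series ring $B[[x;\sigma,\delta]]$ exists: it is the left $B$-module of formal power series $\sum_j b_jx^j$ with the continuous multiplication extending $xr=\sigma(r)x+\delta(r)$ $(r\in B)$, and it is again complete local. If $A\subseteq B$ is a subring, $(\sigma,\delta)$ is $A$-linear if $\sigma(a)=a$ and $\delta(a)=0$ for all $a\in A$. The ring $R$ is one of the following. Case $(A_\triangle)$: $A=k$ is a finite field of characteristic $p$, $R_0=A$, and for $1\le i\le n$, $R_i=R_{i-1}[[x_i;\sigma_i,\delta_i]]$ with $(\sigma_i,\delta_i)$ a local, $A$-linear skew derivation on $R_{i-1}$ which is triangular, i.e. restricts to a skew derivation of $R_j$ (so $\sigma_i(R_j)\subseteq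 R_j$, $\delta_i(R_j)\subseteq R_j$) for every $0\le j\le i-1$. Put $R=R_n$. Case $(B_\triangle)$: $A$ is a (commutative) complete discrete valuation ring of characteristic $0$, not a field, with residue field $k$ a finite field of characteristic $p$; $x_1$ is a fixed uniformiser of $A$; $R_1=A$, and for $2\le i\le n$, $R_i=R_{i-1}[[x_i;\sigma_i,\delta_i]]$ with $(\sigma_i,\delta_i)$ a local, $A$-linear skew derivation on $R_{i-1}$ which is triangular, i.e. restricts to a skew derivation of $R_j$ for every $1\le j\le i-1$. Put $R=R_n$. Let $\iota:k\to A$ be the unique multiplicative section of $A\to k$ (the identity in the first case). For $\alpha\in\mathbb{N}^n$ write $x^\alpha=x_1^{\alpha_1}\cdots x_n^{\alpha_n}$. Every $r\in R$ is uniquely $r=\sum_{\alpha\in\mathbb{N}^n}r_\alpha x^\alpha$ with $r_\alpha\in\iota(k)$; $\mathrm{supp}(r)=\{\alpha:r_\alpha\ne0\}$. An additive total order on $\mathbb{N}^n$ is a total order with $0\prec\alpha$ for all $\alpha\neq 0$, and $\alpha\prec\beta\Rightarrow\alpha+\gamma\prec\beta+\gamma$ (it is automatically a well-order). For $r\ne0$, $\mathrm{LM}_\preceq(r)=\min_\preceq\mathrm{supp}(r)$. An additive total order is a monomial order on $R$ if $\mathrm{LM}_\preceq(x^\alpha x^\beta)=\alpha+\beta$ for all $\alpha,\beta$. Let $e_i$ be the $i$th standard basis vector of $\mathbb{Z}^n$. An elementary shuffle is an element $e_i-e_j$ with $i\le j$; a shuffle is a finite sum of elementary shuffles; $\mathcal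 S_n\subseteq\mathbb{Z}^n$ is the set of shuffles. For $\alpha\in\mathbb{N}^n$ let $E(\alpha)=(\alpha+\mathcal S_n)\cap\mathbb{N}^n$ and $F(\alpha)=\bigcup_{\beta\in E(\alpha)}(\beta+\mathbb{N}^n)$. Define the partial order $\alpha\le_F\beta\iff\beta\in F(\alpha)$. An additive total order $\preceq$ is triangular if $\alpha\le_F\beta$ implies $\alpha\preceq\beta$. *)

(* Defs.v *)
From HB Require Import structures.
From mathcomp Require Import all_boot all_order all_algebra finmap.
From mathcomp Require Import boolp classical_sets functions.

Set Implicit Arguments.
Unset Strict Implicit.
Unset Printing Implicit Defensive.

Import Order.TTheory GRing.Theory.

Local Open Scope classical_set_scope.
Local Open Scope ring_scope.

(* All the rings R_i of an iterated extension are handled as subrings of the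
   last one, R = R_n; hence the notions below are relative to a subset [B] of an
   ambient ring [R], and maps between subrings are total functions on [R] of
   which only the values on the relevant subring matter. *)

Section LocalRings.
Variable R : nzRingType.
Implicit Types (B S I J m : set R) (sigma delta : R -> R).

Definition subring B : Prop :=
  [/\ B 1, forall a b, B a -> B b -> B (a - b)
    & forall a b, B a -> B b -> B (a * b)].

Definition left_ideal B I : Prop :=
  [/\ I `<=` B, I 0, forall a b, I a -> I b -> I (a + b)
    & forall b a, B b -> I a -> I (b * a)].

Definition maximal_left_ideal B I : Prop :=
  [/\ left_ideal B I, I <> B
    & forall J, left_ideal B J -> I `<=` J -> J = I \/ J = B].

Definition ideal_mul I J : set R :=
  [set r | exists2 s : seq (R * R),
      forall q, q \in s -> I q.1 /\ J q.2 & r = \sum_(q <- s) q.1 * q.2].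

Definition ideal_pow B m (N : nat) : set R := iter N (ideal_mul m) B.

(* [B] is not assumed commutative: it is local when it has a unique maximal
   left ideal, which is then automatically two-sided and also the unique
   maximal right ideal. *)
Definition local_ring B m : Prop :=
  [/\ subring B, maximal_left_ideal B m
    & forall I, maximal_left_ideal B I -> I = m].

Definition adically_separated B m : Prop :=
  forall r, (forall N, ideal_pow B m N r) -> r = 0.

Definition adically_complete B m : Prop :=
  forall u : nat -> R, (forall i, B (u i)) ->
  (forall N, exists M, forall i j, (M <= i)%N -> (M <= j)%N ->
     ideal_pow B m N (u i - u j)) ->
  exists2 l, B l &
    forall N, exists M, forall i, (M <= i)%N -> ideal_pow B m N (u i - l).

Definition complete_local B m : Prop :=
  [/\ local_ring B m, adically_separated B m & adically_complete B m].

Definition ring_automorphism B sigma : Prop :=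
  [/\ set_bij B B sigma, sigma 1 = 1,
      forall a b, B a -> B b -> sigma (a + b) = sigma a + sigma b
    & forall a b, B a -> B b -> sigma (a * b) = sigma a * sigma b].

Definition skew_derivation B sigma delta : Prop :=
  [/\ ring_automorphism B sigma, forall a, B a -> B (delta a),
      forall a b, B a -> B b -> delta (a + b) = delta a + delta b
    & forall a b, B a -> B b ->
        delta (a * b) = delta a * b + sigma a * delta b].

Definition local_skew_derivation B m sigma delta : Prop :=
  [/\ skew_derivation B sigma delta,
      forall N, sigma @` ideal_pow B m N = ideal_pow B m N
    & forall N, delta @` ideal_pow B m N `<=` ideal_pow B m N.+1].

Definition linear_over (A : set R) sigma delta : Prop :=
  forall a, A a -> sigma a = a /\ delta a = 0.

(* Basic neighbourhoods of 0 in [S], viewed through the coefficient map [coef]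
   as the product of copies of [B] indexed by [nat], each with its [m]-adic
   topology. *)
Definition coef_nbhs0 B m S (coef : R -> nat -> R) (N : nat) : set R :=
  [set r | S r /\ forall j, (j < N)%N -> ideal_pow B m N (coef r j)].

(* [S = B[[x; sigma, delta]]]: the element of [S] written as the formal series
   [\sum_j b_j x^j] is the one with [coef r = b]. *)
Definition skew_power_series_ring B m S (x : R) sigma delta : Prop :=
  subring S /\ exists coef : R -> nat -> R,
  [/\ set_bij S [set b : nat -> R | forall j, B (b j)] coef,
      forall b r s j, B b -> S r -> S s ->
        coef (b * r + s) j = b * coef r j + coef s j,
      forall b i, B b -> S (b * x ^+ i) /\
        forall j, coef (b * x ^+ i) j = if j == i then b else 0,
      forall r s, S r -> S s -> forall N, exists M, forall r' s', S r' -> S s' ->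
        coef_nbhs0 B m S coef M (r' - r) -> coef_nbhs0 B m S coef M (s' - s) ->
        coef_nbhs0 B m S coef N (r' * s' - r * s)
    & forall r, B r -> x * r = sigma r * x + delta r].

End LocalRings.

Definition principal_ideals (A : idomainType) : Prop :=
  forall I : set A, left_ideal setT I -> exists g, I = range (fun a => a * g).

Definition complete_dvr (A : idomainType) (m : set A) : Prop :=
  [/\ principal_ideals A, ~ (forall a : A, a != 0 -> a \is a GRing.unit)
    & complete_local setT m].

Section IteratedExtensions.
Variables (n : nat) (R : nzRingType) (k : finFieldType).
(* [Rs i] is R_i and [m i] its maximal ideal. Indices in ['I_n] start at 0: for
   [i : 'I_n], the elements [x i], [sigma i], [delta i] are x_{i+1},
   sigma_{i+1}, delta_{i+1}, and [sigma i], [delta i] live on R_i. *)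
Variables (Rs m : nat -> set R) (x : 'I_n -> R) (sigma delta : 'I_n -> R -> R).
(* The embedding of [k] in R through the multiplicative section k -> A. *)
Variable iota : k -> R.

(* The triangular tower over the base ring A = R_s. *)
Definition triangular_tower (s : nat) : Prop :=
  [/\ Rs n = setT,
      forall i, (s <= i <= n)%N -> complete_local (Rs i) (m i)
    & forall i : 'I_n, (s <= i)%N ->
      [/\ local_skew_derivation (Rs i) (m i) (sigma i) (delta i),
          linear_over (Rs s) (sigma i) (delta i),
          forall j, (s <= j <= i)%N ->
            skew_derivation (Rs j) (sigma i) (delta i)
        & skew_power_series_ring (Rs i) (m i) (Rs i.+1)
            (x i) (sigma i) (delta i)]].

Definition type_A (p : nat) : Prop :=
  p \in [pchar k] /\
  exists phi : {rmorphism k -> R},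
    [/\ Rs 0 = range phi, iota =1 phi & triangular_tower 0].

(* [pi] is the residue map A -> k and [tau] its multiplicative section. *)
Definition type_B (p : nat) : Prop :=
  [/\ p \in [pchar k], (0 < n)%N
    & exists (A : idomainType) (mA : set A) (phi : {rmorphism A -> R})
             (pi : {rmorphism A -> k}) (tau : k -> A) (w : A),
      [/\ complete_dvr mA, [pchar A] =i pred0, mA = [set a | pi a = 0]
        & mA = range (fun a => a * w)] /\
      [/\ cancel tau pi, {morph tau : a b / a * b} & iota =1 phi \o tau] /\
      [/\ injective phi, Rs 1 = range phi,
          forall i : 'I_n, i = 0%N :> nat -> x i = phi w
        & triangular_tower 1]].

(* Big products over ['I_n] are taken in increasing order of the index. *)
Definition monomial (alpha : 'rV[nat]_n) : R :=
  \prod_(i < n) x i ^+ alpha 0 i.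

(* [r = \sum_alpha c_alpha x^alpha] with all [c_alpha] in iota(k), the sum being
   the limit of its finite partial sums for the topology of R = R_n. *)
Definition expansion (r : R) (c : 'rV[nat]_n -> R) : Prop :=
  (forall alpha, range iota (c alpha)) /\
  forall N, exists D0 : {fset 'rV[nat]_n}, forall D : {fset 'rV[nat]_n},
    (D0 `<=` D)%fset ->
    ideal_pow (Rs n) (m n) N (r - \sum_(alpha <- D) c alpha * monomial alpha).

Definition supp (r : R) : set 'rV[nat]_n :=
  [set alpha | exists2 c, expansion r c & c alpha != 0].

Definition is_LM (le : rel 'rV[nat]_n) (r : R) (gamma : 'rV[nat]_n) : Prop :=
  [/\ r != 0, supp r gamma & forall beta, supp r beta -> le gamma beta].

End IteratedExtensions.

Section Orders.
Variable n : nat.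
Implicit Types (alpha beta gamma : 'rV[nat]_n) (le : rel 'rV[nat]_n).

Definition additive_total_order le : Prop :=
  let lt alpha beta := (alpha != beta) && le alpha beta in
  [/\ reflexive le, antisymmetric le, transitive le & total le] /\
  (forall alpha, alpha != 0 -> lt 0 alpha) /\
  (forall alpha beta gamma,
     lt alpha beta -> lt (alpha + gamma) (beta + gamma)).

Definition basis_vector (i : 'I_n) : 'rV[int]_n := delta_mx 0 i.

Definition elementary_shuffle : set 'rV[int]_n :=
  [set v | exists i j : 'I_n,
      (i <= j)%N /\ v = basis_vector i - basis_vector j].

Definition shuffle : set 'rV[int]_n :=
  [set v | exists2 s : seq 'rV[int]_n,
      forall u, u \in s -> elementary_shuffle u & v = \sum_(u <- s) u].

Definition to_int alpha : 'rV[int]_n := map_mx Posz alpha.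

Definition E_set alpha : set 'rV[nat]_n :=
  [set beta | exists2 v, shuffle v & to_int beta = to_int alpha + v].

Definition F_set alpha : set 'rV[nat]_n :=
  \bigcup_(beta in E_set alpha) range (fun gamma => beta + gamma).

Definition le_F alpha beta : Prop := F_set alpha beta.

Definition triangular_order le : Prop :=
  forall alpha beta, le_F alpha beta -> le alpha beta.

End Orders.

Definition monomial_order (n : nat) (R : nzRingType) (k : finFieldType)
    (Rs m : nat -> set R) (x : 'I_n -> R) (iota : k -> R)
    (le : rel 'rV[nat]_n) : Prop :=
  additive_total_order le /\
  forall alpha beta : 'rV[nat]_n,
    is_LM Rs m x iota le (monomial x alpha * monomial x beta) (alpha + beta).

(* Main.v *)
(* For each [l] let [w_l alpha] be the sum of the first [l] entries of [alpha];
   then [alpha <=_F beta] exactly when [w_l alpha <= w_l beta] for all [l].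
   Triangularity makes the closed ideal generated by the [d]-th power of the
   maximal ideal of R_l two-sided in R, and it consists of the series all of
   whose monomials have [w_l >= d]. These ideals multiply like filtrations, so
   every monomial of x^alpha x^beta lies in F(alpha + beta). For t < i one has
   x_t x_i = c x_i x_t + (higher terms) with c in iota(k), where "higher" means
   that some [w_l] increases; sorting x^(alpha + beta) into x^alpha x^beta gives
   x^(alpha + beta) = c x^alpha x^beta + (higher terms), so the coefficient of
   x^alpha x^beta at alpha + beta cannot vanish. *)

Require Import Defs.
From mathcomp Require Import all_boot all_order all_algebra finmap.
From mathcomp Require Import boolp classical_sets functions.
From mathcomp Require Import zify.

Set Implicit Arguments.
Unset Strict Implicit.
Unset Printing Implicit Defensive.

Import Order.TTheory GRing.Theory.

Local Open Scope classical_set_scope.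
Local Open Scope ring_scope.

(** * Ideals of local rings *)

(** Over a valuation ring [iota] is multiplicative but not additive, so digits in iota(k) are not
    linear functionals. Membership in a weight filtration is therefore expressed as agreement of the
    digits of two elements, and higher terms are discarded one summand at a time. Sorting runs from
    x^(alpha + beta), whose digit is known to be 1, towards x^alpha x^beta, so none of the scalars
    met on the way has to be shown nonzero beforehand. They can be pulled out of products because
    linearity over A makes iota(k) commute with every variable.

    The weight ideals are stable under sigma_i and delta_i because the powers of the maximal ideal
    of a larger ring of the tower meet a smaller one in the powers of its own maximal ideal:
    together with triangularity, this lets locality descend to every R_l. Above level l the
    filtration is coefficientwise. The coefficient map is only known to be left linear with a
    continuous product, so products and images are computed on truncations, and each filtration
    carries a closedness property that passes to the limit. *)

Definition additive_subgroup (R : nzRingType) (G : set R) : Prop :=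
  G 0 /\ forall a b, G a -> G b -> G (a - b).

Section AdditiveSubgroups.
Variables (R : nzRingType) (G : set R).
Hypothesis addG : additive_subgroup G.

Lemma additive_subgroupN a : G a -> G (- a).
Proof. by case: addG => G0 GB Ga; rewrite -[- a]add0r; apply: GB. Qed.

Lemma additive_subgroupD a b : G a -> G b -> G (a + b).
Proof.
by case: addG => G0 GB Ga Gb; rewrite -[b]opprK; apply/GB/additive_subgroupN.
Qed.

Lemma additive_subgroup_sum (I : eqType) (s : seq I) (P : pred I) (f : I -> R) :
  (forall i, i \in s -> P i -> G (f i)) -> G (\sum_(i <- s | P i) f i).
Proof.
move=> Gf; rewrite big_seq_cond; apply: big_ind => [|a b|i /andP[]].
- by case: addG.
- exact: additive_subgroupD.
- exact: Gf.
Qed.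

End AdditiveSubgroups.

Section IdealPowers.
Variable R : nzRingType.
Implicit Types (B I J G m : set R).

Lemma ideal_mul_mem I J a b : I a -> J b -> ideal_mul I J (a * b).
Proof.
move=> Ia Jb; exists [:: (a, b)]; last by rewrite big_seq1.
by move=> q; rewrite inE => /eqP->.
Qed.

Lemma ideal_mul_ind I J G r : additive_subgroup G ->
  (forall a b, I a -> J b -> G (a * b)) -> ideal_mul I J r -> G r.
Proof.
move=> addG GIJ [s sIJ ->]; apply: additive_subgroup_sum => // q qs _.
by have [Iq Jq] := sIJ q qs; apply: GIJ.
Qed.

Lemma ideal_mul_additive I J :
  additive_subgroup I -> additive_subgroup (ideal_mul I J).
Proof.
move=> addI; split; first by exists [::] => //; rewrite big_nil.
move=> _ _ [s sIJ ->] [t tIJ ->].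
exists (s ++ [seq (- q.1, q.2) | q <- t]).
  move=> q; rewrite mem_cat => /orP[/sIJ //|/mapP[q' /tIJ[Iq Jq] ->]].
  by split=> //=; apply: additive_subgroupN.
rewrite big_cat big_map /=; congr (_ + _).
by rewrite -sumrN; apply: eq_bigr => q _; rewrite mulNr.
Qed.

Lemma subring_additive B : subring B -> additive_subgroup B.
Proof. by case=> B1 BB BM; split=> //; rewrite -(subrr 1); apply: BB. Qed.

Lemma subringX B b N : subring B -> B b -> B (b ^+ N).
Proof.
case=> B1 BB BM Bb; elim: N => [|N IH]; first by rewrite expr0.
by rewrite exprS; apply: BM.
Qed.

Lemma left_ideal_additive B I : subring B -> left_ideal B I ->
  additive_subgroup I.
Proof.
move=> sB [IB I0 ID IM]; split=> // a b Ia Ib; apply: ID => //.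
rewrite -mulN1r; apply: IM => //.
by apply: (additive_subgroupN (subring_additive sB)); case: sB.
Qed.

Lemma maximal_left_ideal1 B m : subring B -> maximal_left_ideal B m -> ~ m 1.
Proof.
move=> sB [[mB m0 mD mM] neqmB _] m1; apply: neqmB; apply/seteqP; split=> // b Bb.
by rewrite -[b]mulr1; apply: mM.
Qed.

(** The left ideal [J = B b + m] contains [m] and [b], so maximality makes it all of [B], and
    writing 1 as an element of it gives [c]. *)
Lemma maximal_left_ideal_gen B m b : subring B -> maximal_left_ideal B m ->
  B b -> ~ m b -> exists2 c, B c & m (c * b - 1).
Proof.
move=> sB mmax Bb nmb; have [lm neqmB maxm] := mmax; have [mB m0 mD mM] := lm.
have addm := left_ideal_additive sB lm; have addB := subring_additive sB.
have [B1 BB BM] := sB.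
pose J := [set r | exists c d, [/\ B c, m d & r = c * b + d]].
have lJ : left_ideal B J.
  split.
  - move=> _ [c [d [Bc md ->]]]; apply: (additive_subgroupD addB); last exact: mB.
    exact: BM.
  - by exists 0, 0; split=> //; [case: addB | rewrite mul0r addr0].
  - move=> _ _ [c [d [Bc md ->]]] [c' [d' [Bc' md' ->]]].
    exists (c + c'), (d + d'); split; [exact: additive_subgroupD|exact: mD|].
    by rewrite mulrDl addrACA.
  - move=> a _ Ba [c [d [Bc md ->]]]; exists (a * c), (a * d).
    by split; [exact: BM|exact: mM|rewrite mulrDr mulrA].
have mJ : m `<=` J.
  by move=> d md; exists 0, d; split=> //; [case: addB|rewrite mul0r add0r].
have Jb : J b by exists 1, 0; split=> //; rewrite mul1r addr0.
have [eJ|eJ] := maxm _ lJ mJ; first by rewrite eJ in Jb.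
have : J 1 by rewrite eJ.
move=> [c [d [Bc md e]]]; exists c => //.
by rewrite e opprD addrA subrr add0r; apply: additive_subgroupN.
Qed.

(* If [b] is not in [m], then [{r | r b \in m}] is again a maximal left ideal,
   hence equal to [m]. *)
Lemma local_ring_mulr B m a b : local_ring B m -> m a -> B b -> m (a * b).
Proof.
move=> [sB mmax uniqm] ma Bb; have [lm neqmB maxm] := mmax.
have [mB m0 mD mM] := lm; have [B1 BB BM] := sB.
have [mb|nmb] := pselect (m b); first by apply: mM => //; exact: mB.
have addm := left_ideal_additive sB lm.
pose K := [set r | B r /\ m (r * b)].
suff Km : K = m by move: ma; rewrite -{1}Km => -[].
have addB := subring_additive sB; apply: uniqm; split.
- split.
  + by move=> r [].
  + by split; [case: addB | rewrite mul0r].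
  + move=> r t [Br mr] [Bt mt]; split; first exact: additive_subgroupD.
    by rewrite mulrDl; apply: mD.
  + by move=> r t Br [Bt mt]; split; [exact: BM | rewrite -mulrA; apply: mM].
- by move=> eK; apply: nmb; have := B1; rewrite -eK => -[_]; rewrite mul1r.
- move=> J lJ KJ; have [eJ|neJ] := pselect (J = K); [by left | right].
  have [JB J0 JD JM] := lJ.
  have [r [Jr nKr]] : exists r, J r /\ ~ K r.
    apply: contra_notP neJ => /forallNP nex; apply/seteqP; split=> // r Jr.
    by apply: contrapT => nKr; apply: (nex r).
  have nmrb : ~ m (r * b) by move=> mrb; apply: nKr; split=> //; exact: JB.
  have [c Bc mc] : exists2 c, B c & m (c * (r * b) - 1).
    apply: (maximal_left_ideal_gen sB mmax) => //.
    by apply: (BM _ _ (JB _ Jr)).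
  (* Indeed [(b * c * r - 1) * b = b * (c * (r * b) - 1)] lies in [m], so the element is in [K]. *)
  have J1 : J (b * c * r - 1).
    apply: KJ; split; first by apply: (BB _ _ (BM _ _ _ (JB _ Jr)) B1); exact: BM.
    rewrite mulrBl mul1r -{3}[b]mulr1 -!mulrA -mulrBr; exact: mM.
  have : J 1.
    rewrite -[1](subKr (b * c * r)).
    apply: (additive_subgroupD (left_ideal_additive sB lJ)).
      by apply: JM; [exact: BM|].
    exact: (additive_subgroupN (left_ideal_additive sB lJ)).
  by move=> J1'; apply/seteqP; split=> // a' Ba'; rewrite -[a']mulr1; apply: JM.
Qed.

Definition two_sided_ideal B m : Prop :=
  [/\ m `<=` B, additive_subgroup m, forall b a, B b -> m a -> m (b * a)
    & forall a b, m a -> B b -> m (a * b)].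

Lemma local_two_sided B m : local_ring B m -> two_sided_ideal B m.
Proof.
move=> locB; have [sB [lm _ _] _] := locB; have [mB m0 mD mM] := lm; split=> //.
  exact: left_ideal_additive lm.
by move=> a b; apply: local_ring_mulr.
Qed.

Section Powers.
Variables B m : set R.
Hypotheses (sB : subring B) (idm : two_sided_ideal B m).

Let mB : m `<=` B. Proof. by case: idm. Qed.
Let addm : additive_subgroup m. Proof. by case: idm. Qed.
Let mMl b a : B b -> m a -> m (b * a). Proof. by case: idm => _ _ + _; apply. Qed.
Let mMr a b : m a -> B b -> m (a * b). Proof. by case: idm => _ _ _; apply. Qed.
Let BM a b : B a -> B b -> B (a * b). Proof. by case: sB => _ _; apply. Qed.
Let B1 : B 1. Proof. by case: sB. Qed.

Lemma ideal_pow_additive N : additive_subgroup (ideal_pow B m N).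
Proof.
by case: N => [|N]; [exact: subring_additive | exact: ideal_mul_additive].
Qed.

Lemma ideal_powM M N a b : ideal_pow B m M a -> ideal_pow B m N b ->
  ideal_pow B m (M + N) (a * b).
Proof.
have H0 N' c d : B c -> ideal_pow B m N' d -> ideal_pow B m N' (c * d).
  elim: N' d => [|N' IH] d Bc; first exact: BM.
  apply: (@ideal_mul_ind _ _ [set d | ideal_pow B m N'.+1 (c * d)]) => [|a' b' ma' pb'].
    have [p0 pB] := ideal_pow_additive N'.+1.
    split; rewrite /= ?mulr0 // => u v pu pv; rewrite mulrBr; exact: pB.
  by rewrite /= mulrA; apply: ideal_mul_mem => //; apply: mMl.
elim: M a => [|M IH] a; first exact: H0.
move=> pa pb; move: pa.
apply: (@ideal_mul_ind _ _ [set a | ideal_pow B m (M.+1 + N) (a * b)])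
  => [|a' b' ma' pb'].
  have [p0 pB] := ideal_pow_additive (M.+1 + N).
  split; rewrite /= ?mul0r // => u v pu pv; rewrite mulrBl; exact: pB.
rewrite /= -mulrA; apply: ideal_mul_mem => //; exact: IH.
Qed.

Lemma ideal_pow_sub N : ideal_pow B m N `<=` B.
Proof.
case: N => [//|N] r; apply: ideal_mul_ind; first exact: subring_additive.
elim: N => [|N IH] a b ma; first by move=> ?; apply: BM => //; exact: mB.
move=> pb; apply: BM; first exact: mB.
exact: (ideal_mul_ind (subring_additive sB) IH pb).
Qed.

Lemma ideal_powS_sub N : ideal_pow B m N.+1 `<=` ideal_pow B m N.
Proof.
move=> r; apply: ideal_mul_ind; first exact: ideal_pow_additive.
by move=> a b ma pb; apply: (@ideal_powM 0 N) => //; exact: mB.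
Qed.

Lemma ideal_pow_le M N : (M <= N)%N -> ideal_pow B m N `<=` ideal_pow B m M.
Proof.
move=> /subnK <-; elim: (N - M)%N => [//|K IH].
by rewrite addSn => r /ideal_powS_sub/IH.
Qed.

Lemma ideal_pow1 : ideal_pow B m 1 = m.
Proof.
apply/seteqP; split=> [r|r mr]; first by apply: ideal_mul_ind.
by rewrite -[r]mulr1; apply: ideal_mul_mem.
Qed.

Lemma ideal_powX N a : m a -> ideal_pow B m N (a ^+ N).
Proof.
move=> ma; elim: N => [//|N IH]; rewrite exprS; exact: ideal_mul_mem.
Qed.

End Powers.

End IdealPowers.

(** * The skew power series step *)

(** [filt_closed] is closedness in the [m]-adic topology; through it, membership of an infinite
    series is tested on its truncations. *)
Record filtration (R : nzRingType) (B m : set R) (F : nat -> set R) : Prop :=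
  Filtration {
    filt0 : F 0 = B;
    filt_additive : forall d, additive_subgroup (F d);
    filtS_sub : forall d, F d.+1 `<=` F d;
    filtM : forall d e a b, F d a -> F e b -> F (d + e)%N (a * b);
    filt_closed : forall d r, B r ->
      (forall N, exists2 f, F d f & ideal_pow B m N (r - f)) -> F d r }.

Section Filtrations.
Variables (R : nzRingType) (B m : set R) (F : nat -> set R).
Hypothesis filtF : filtration B m F.

Lemma filt_le d e : (d <= e)%N -> F e `<=` F d.
Proof.
move=> /subnK <-; elim: (e - d)%N => [//|k IH].
by rewrite addSn => r /(filtS_sub filtF)/IH.
Qed.

Lemma filt_sub d : F d `<=` B.
Proof. by rewrite -(filt0 filtF); apply: filt_le. Qed.

Lemma filt_zero d : F d 0.
Proof. by case: (filt_additive filtF d). Qed.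

Lemma filtMl d a b : B a -> F d b -> F d (a * b).
Proof. by rewrite -(filt0 filtF) => Fa Fb; apply: (filtM filtF Fa Fb). Qed.

Lemma filtMr d a b : F d a -> B b -> F d (a * b).
Proof. by rewrite -(filt0 filtF) -{2}[d]addn0; apply: filtM filtF _ _ _ _. Qed.

End Filtrations.

Lemma ideal_pow_filtration (R : nzRingType) (B m : set R) :
  subring B -> two_sided_ideal B m -> filtration B m (ideal_pow B m).
Proof.
move=> sB idm; split=> //.
- exact: ideal_pow_additive.
- exact: ideal_powS_sub.
- by move=> d e a b; apply: ideal_powM.
- move=> d r Br /(_ d)[f pf]; rewrite -{2}[r](subrK f) => prf.
  by apply: additive_subgroupD => //; exact: ideal_pow_additive.
Qed.

(** The variable gets weight [e], which is 0 or 1 in the tower. By truncated subtraction a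
    coefficient with [e * j >= d] only has to lie in [F 0], the whole base. *)
Definition skew_filtration (R : nzRingType) (S : set R)
    (coef : R -> nat -> R) (F : nat -> set R) (e d : nat) : set R :=
  [set r | S r /\ forall j, F (d - e * j)%N (coef r j)].

(** The body of the existential in [skew_power_series_ring], named so that one coefficient map can
    be fixed for each level. *)
Definition skew_coefficients (R : nzRingType) (B m S : set R) (x : R)
    (sg dl : R -> R) (coef : R -> nat -> R) : Prop :=
  [/\ set_bij S [set b : nat -> R | forall j, B (b j)] coef,
      forall b r s j, B b -> S r -> S s ->
        coef (b * r + s) j = b * coef r j + coef s j,
      forall b i, B b -> S (b * x ^+ i) /\
        forall j, coef (b * x ^+ i) j = if j == i then b else 0,
      forall r s, S r -> S s -> forall N, exists M, forall r' s', S r' -> S s' ->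
        coef_nbhs0 B m S coef M (r' - r) -> coef_nbhs0 B m S coef M (s' - s) ->
        coef_nbhs0 B m S coef N (r' * s' - r * s)
    & forall r, B r -> x * r = sg r * x + dl r].

Section SkewStep.
Variables (R : nzRingType) (B m S mS : set R) (x : R) (sg dl : R -> R).
Variable coef : R -> nat -> R.
Hypotheses (clB : complete_local B m) (clS : complete_local S mS).
Hypothesis lsd : local_skew_derivation B m sg dl.
Hypothesis coefP : skew_coefficients B m S x sg dl coef.

Let coef_bij : set_bij S [set b : nat -> R | forall j, B (b j)] coef.
Proof. by case: coefP. Qed.
Let coef_linear b r s j : B b -> S r -> S s ->
  coef (b * r + s) j = b * coef r j + coef s j.
Proof. by case: coefP => _ + _ _ _; apply. Qed.
Let coef_mon b i : B b -> S (b * x ^+ i) /\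
  forall j, coef (b * x ^+ i) j = if j == i then b else 0.
Proof. by case: coefP => _ _ + _ _; apply. Qed.
Let mul_continuous r s : S r -> S s ->
  forall N, exists M, forall r' s', S r' -> S s' ->
    coef_nbhs0 B m S coef M (r' - r) -> coef_nbhs0 B m S coef M (s' - s) ->
    coef_nbhs0 B m S coef N (r' * s' - r * s).
Proof. by case: coefP => _ _ _ + _; apply. Qed.
Let x_comm r : B r -> x * r = sg r * x + dl r.
Proof. by case: coefP => _ _ _ _; apply. Qed.

Let sB : subring B. Proof. by case: clB => -[]. Qed.
Let sS : subring S. Proof. by case: clS => -[]. Qed.
Let addB := subring_additive sB.
Let addS := subring_additive sS.
Let B1 : B 1. Proof. by case: sB. Qed.
Let S1 : S 1. Proof. by case: sS. Qed.
Let idm : two_sided_ideal B m. Proof. by case: clB => /local_two_sided. Qed.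
Let idmS : two_sided_ideal S mS. Proof. by case: clS => /local_two_sided. Qed.
Let SM a b : S a -> S b -> S (a * b). Proof. by case: sS => _ _; apply. Qed.
Let SB a b : S a -> S b -> S (a - b). Proof. by case: addS => _; apply. Qed.
Let Bm1 : B (-1). Proof. exact: additive_subgroupN. Qed.

Lemma skew_mem_mon b i : B b -> S (b * x ^+ i).
Proof. by move=> Bb; case: (coef_mon i Bb). Qed.

Lemma coef_monE b i j :
  B b -> coef (b * x ^+ i) j = if j == i then b else 0.
Proof. by move=> Bb; case: (coef_mon i Bb). Qed.

Lemma skew_mem_base b : B b -> S b.
Proof. by move=> /(coef_mon 0)[]; rewrite expr0 mulr1. Qed.

Lemma skew_mem_var : S x.
Proof. by have [+ _] := coef_mon 1 B1; rewrite expr1 mul1r. Qed.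

Let SX i : S (x ^+ i). Proof. exact: subringX skew_mem_var. Qed.

Lemma coef_base b j : B b -> coef b j = if j == 0%N then b else 0.
Proof. by move=> /(coef_mon 0)[_ <-]; rewrite expr0 mulr1. Qed.

Lemma coef_mem r j : S r -> B (coef r j).
Proof. by case: coef_bij => cS _ _ Sr; apply: (cS r Sr). Qed.

Lemma skew_coefD r s j : S r -> S s -> coef (r + s) j = coef r j + coef s j.
Proof. by move=> Sr Ss; rewrite -{1}[r]mul1r coef_linear // mul1r. Qed.

Lemma skew_coef0 j : coef 0 j = 0.
Proof. by rewrite coef_base ?if_same //; case: addB. Qed.

Lemma skew_coefM b r j : B b -> S r -> coef (b * r) j = b * coef r j.
Proof.
move=> Bb Sr; rewrite -[b * r]addr0 coef_linear ?skew_coef0 ?addr0 //.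
by case: addS.
Qed.

Lemma skew_coefB r s j : S r -> S s -> coef (r - s) j = coef r j - coef s j.
Proof.
by move=> Sr Ss; rewrite addrC -mulN1r coef_linear // mulN1r addrC.
Qed.

Lemma skew_coef_sum (I : eqType) (s : seq I) (P : pred I) (f : I -> R) j :
  (forall i, i \in s -> S (f i)) ->
  coef (\sum_(i <- s | P i) f i) j = \sum_(i <- s | P i) coef (f i) j.
Proof.
elim: s => [|i s IH] Sf; first by rewrite !big_nil skew_coef0.
have Sf' i' : i' \in s -> S (f i') by move=> is_; apply: Sf; rewrite inE is_ orbT.
rewrite !big_cons; case: ifP => _; last exact: IH.
rewrite skew_coefD ?IH //; first by apply: Sf; rewrite inE eqxx.
by apply: (additive_subgroup_sum addS) => i' /Sf'.
Qed.

Lemma coef_inj r s : S r -> S s -> (forall j, coef r j = coef s j) -> r = s.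
Proof.
case: coef_bij => _ inj _ Sr Ss e; apply: inj; rewrite ?inE //.
exact/funext.
Qed.

Definition skew_trunc r N := \sum_(0 <= j < N) coef r j * x ^+ j.

Lemma skew_trunc_mem r N : S r -> S (skew_trunc r N).
Proof.
move=> Sr; apply: (additive_subgroup_sum addS) => j _ _.
by case: (coef_mon j (coef_mem j Sr)).
Qed.

Lemma coef_trunc r N j : S r ->
  coef (skew_trunc r N) j = if (j < N)%N then coef r j else 0.
Proof.
move=> Sr; rewrite skew_coef_sum => [|i _]; last by case: (coef_mon i (coef_mem i Sr)).
under eq_bigr => i _ do rewrite (coef_mon i (coef_mem i Sr)).2.
rewrite -big_mkcond /= ; under eq_bigl => i do rewrite eq_sym.
by rewrite big_nat1_eq.
Qed.

Lemma trunc_nbhs r N : S r -> coef_nbhs0 B m S coef N (skew_trunc r N - r).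
Proof.
move=> Sr; have St := skew_trunc_mem N Sr; split=> [|j jN]; first exact: SB.
rewrite skew_coefB // coef_trunc // jN subrr.
by case: (ideal_pow_additive sB idm N).
Qed.

Let nbhs00 N r : coef_nbhs0 B m S coef N (r - r).
Proof.
rewrite subrr; split=> [|j _]; first by case: addS.
by rewrite skew_coef0; case: (ideal_pow_additive sB idm N).
Qed.

(** Coefficients are only given as left linear. On truncations the shift is read off from monomials;
    continuity of the product and separatedness of [B] extend it to all series. *)
Lemma coef_mulx r j : S r ->
  coef (r * x) j = if j is j'.+1 then coef r j' else 0.
Proof.
move=> Sr; have Sx := skew_mem_var.
have cB : B (if j is j'.+1 then coef r j' else 0).
  by case: j => [|j']; [case: addB | exact: coef_mem].
apply/eqP; rewrite -subr_eq0; apply/eqP; case: clB => _ + _; apply => N.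
(* In [coef_nbhs0] one number bounds both the index and the [m]-adic precision, so [maxn N j.+1]
   controls coefficient [j] to precision [N]. *)
have [M Mcont] := mul_continuous Sr Sx (maxn N j.+1).
pose t := skew_trunc r (maxn M j.+1); have St : S t by exact: skew_trunc_mem.
have nM : coef_nbhs0 B m S coef M (t - r).
  split=> [|i iM]; first exact: SB.
  apply: (ideal_pow_le sB idm (leq_maxl M j.+1)).
  by case: (trunc_nbhs (maxn M j.+1) Sr) => _; apply; rewrite leq_max iM.
have [_ /(_ j)] := Mcont t x St Sx nM (nbhs00 _ _).
rewrite leq_max ltnSn orbT => /(_ isT).
rewrite skew_coefB; [|exact: SM|exact: SM].
have -> : coef (t * x) j = if j is j'.+1 then coef r j' else 0.
  rewrite /t /skew_trunc mulr_suml skew_coef_sum => [|i _]; last first.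
    by apply: SM => //; case: (coef_mon i (coef_mem i Sr)).
  under eq_bigr => i _ do
    rewrite -mulrA -exprSr (coef_mon i.+1 (coef_mem i Sr)).2.
  case: j {nM cB Mcont St t} => [|j'].
    by rewrite big1.
  rewrite -big_mkcond /=; under eq_bigl => i do rewrite eqSS eq_sym.
  by rewrite big_nat1_eq leq0n leq_max leqnSn orbT.
move=> /(additive_subgroupN (ideal_pow_additive sB idm _)); rewrite opprB.
by apply: ideal_pow_le => //; rewrite leq_maxl.
Qed.

Lemma coef_mulX r i j : S r ->
  coef (r * x ^+ i) j = if (i <= j)%N then coef r (j - i)%N else 0.
Proof.
move=> Sr; elim: i j => [|i IH] j; first by rewrite expr0 mulr1 subn0.
rewrite exprSr mulrA coef_mulx; last exact: SM.
case: j => [//|j].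
by rewrite IH ltnS subSS.
Qed.

Section Filtration.
Variables (F : nat -> set R) (e : nat).
Hypothesis filtF : filtration B m F.
Hypothesis sgF : forall d r, F d r -> F d (sg r).
Hypothesis dlF : forall d r, F d r -> F (d + e)%N (dl r).

Local Notation G := (skew_filtration S coef F e).

Lemma skew_filt_additive d : additive_subgroup (G d).
Proof.
split=> [|a b [Sa Fa] [Sb Fb]].
  by split=> [|j]; [case: addS | rewrite skew_coef0; exact: filt_zero filtF _].
split=> [|j]; first exact: SB.
by rewrite skew_coefB //; case: (filt_additive filtF (d - e * j)) => _; apply.
Qed.

Lemma skew_filt_le d c : (d <= c)%N -> G c `<=` G d.
Proof.
by move=> dc r [Sr Fr]; split=> // j; apply: (filt_le filtF) (Fr j); lia.
Qed.

Lemma skew_filt_coef_closed d r : S r ->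
  (forall N, exists2 g, G d g & coef_nbhs0 B m S coef N (g - r)) -> G d r.
Proof.
move=> Sr cl; split=> // j; apply: (filt_closed filtF); first exact: coef_mem.
move=> N; have [g [Sg Fg] [_ /(_ j)]] := cl (maxn N j.+1).
rewrite leq_max ltnSn orbT => /(_ isT) H; exists (coef g j); first exact: Fg.
rewrite -opprB -skew_coefB //.
  apply: (additive_subgroupN (ideal_pow_additive sB idm _)).
exact: ideal_pow_le (leq_maxl _ _) _ H.
Qed.

Lemma skew_filt_mon c d b j : (d <= c + e * j)%N -> F c b -> G d (b * x ^+ j).
Proof.
move=> dc Fb; have Bb := filt_sub filtF Fb.
have [Sbx cbx] := coef_mon j Bb; split=> // i; rewrite cbx.
case: eqP => [->|_]; last exact: filt_zero filtF _.
by apply: (filt_le filtF) Fb; lia.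
Qed.

Lemma skew_filt_basel c d b r : F c b -> G d r -> G (c + d)%N (b * r).
Proof.
move=> Fb [Sr Fr]; have Bb := filt_sub filtF Fb.
split=> [|j]; first by apply: SM => //; exact: skew_mem_base.
rewrite skew_coefM //; apply: (filt_le filtF) (filtM filtF Fb (Fr j)); lia.
Qed.

(** A term [b * x ^+ j] becomes [sg b * x ^+ j.+1 + dl b * x ^+ j]: the first summand gains [e] from
    its exponent, the second from [dlF]. *)
Lemma skew_filt_varl d r : G d r -> G (d + e)%N (x * r).
Proof.
move=> [Sr Fr]; apply: skew_filt_coef_closed; first exact: SM skew_mem_var Sr.
move=> N; have [M Mcont] := mul_continuous skew_mem_var Sr N.
exists (x * skew_trunc r M); last first.
  apply: Mcont => //; [exact: skew_mem_var|exact: skew_trunc_mem|].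
  exact: trunc_nbhs.
rewrite /skew_trunc mulr_sumr.
apply: (additive_subgroup_sum (skew_filt_additive _)) => j _ _.
rewrite mulrA x_comm; last exact: coef_mem.
rewrite mulrDl -mulrA -exprS; apply: (additive_subgroupD (skew_filt_additive _)).
  by apply: (@skew_filt_mon (d - e * j)); [lia | exact: sgF].
by apply: (@skew_filt_mon (d - e * j + e)); [lia | exact: dlF].
Qed.

(** Truncating the left factor leaves terms [b * (x ^+ j * s)]; multiplying [s] by [x ^+ j] gains
    [e * j], exactly what [b] may lack. *)
Lemma skew_filtM c d r s : G c r -> G d s -> G (c + d)%N (r * s).
Proof.
move=> [Sr Fr] Gs; have [Ss Fs] := Gs.
apply: skew_filt_coef_closed; first exact: SM.
move=> N; have [M Mcont] := mul_continuous Sr Ss N.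
exists (skew_trunc r M * s); last first.
  by apply: Mcont => //; [exact: skew_trunc_mem|exact: trunc_nbhs].
rewrite /skew_trunc mulr_suml.
apply: (additive_subgroup_sum (skew_filt_additive _)) => j _ _.
have Gxs : G (d + e * j)%N (x ^+ j * s).
  elim: j => [|j IH]; first by rewrite muln0 addn0 expr0 mul1r.
  rewrite exprS -mulrA; apply: skew_filt_le (skew_filt_varl IH); lia.
rewrite -mulrA; apply: skew_filt_le (skew_filt_basel (Fr j) Gxs); lia.
Qed.

End Filtration.

Let sgm d r : ideal_pow B m d r -> ideal_pow B m d (sg r).
Proof. by case: lsd => _ sgN _ mr; rewrite -sgN; exists r. Qed.

Let dlm d r : ideal_pow B m d r -> ideal_pow B m (d + 1) (dl r).
Proof. by case: lsd => _ _ dlN mr; rewrite addn1; apply: dlN; exists r. Qed.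

Let filtm := ideal_pow_filtration sB idm.

(** The candidate [J] is step 1 of the filtration built from the powers of [m] with [e = 1], hence a
    left ideal. It is maximal because an element outside it has a constant coefficient that is left
    invertible modulo [m]; locality of [S] then identifies it with [mS]. *)
Lemma skew_maximal_ideal r : mS r <-> S r /\ m (coef r 0).
Proof.
have locS : local_ring S mS by case: clS.
have maxm : maximal_left_ideal B m by case: clB => -[].
have [lm _ _] := maxm; have addm := left_ideal_additive sB lm.
pose J := [set r | S r /\ m (coef r 0%N)].
suff -> : mS = J by [].
symmetry; have [_ _] := locS; apply.
have JE : J = skew_filtration S coef (ideal_pow B m) 1 1.
  apply/seteqP; split=> a [Sa ma]; split=> //; last first.
    by have := ma 0%N; rewrite muln0 subn0 ideal_pow1.
  by move=> [|j]; rewrite ?muln0 ?ideal_pow1 // mul1n /=; exact: coef_mem.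
have lJ : left_ideal S J.
  rewrite JE; split.
  - by move=> a [].
  - by case: (skew_filt_additive 1 filtm 1).
  - by move=> a b; apply: additive_subgroupD; exact: skew_filt_additive.
  - move=> b a Sb; apply: (@skew_filtM _ 1 filtm sgm dlm 0) => //.
    by split=> // j; exact: coef_mem.
split=> //.
  move=> eJ; apply: (maximal_left_ideal1 sB maxm).
  have : J 1 by rewrite eJ.
  by case=> _; rewrite coef_base.
move=> K lK JK; have [KS K0 KD KM] := lK.
have [eK|neK] := pselect (K = J); [by left | right].
have [a [Ka nJa]] : exists a, K a /\ ~ J a.
  apply: contra_notP neK => /forallNP nex; apply/seteqP; split=> // a Ka.
  by apply: contrapT => nJa; apply: (nex a).
have Sa := KS _ Ka; have Bc := coef_mem 0 Sa.
have nmc : ~ m (coef a 0%N) by move=> mc; apply: nJa.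
have [b Bb mb] := maximal_left_ideal_gen sB maxm Bc nmc.
have Jba : J (b * a - 1).
  have Sb := skew_mem_base Bb.
  have Sba := SM Sb Sa.
  by split; [exact: SB | rewrite skew_coefB // skew_coefM // (coef_base 0 B1)].
have K1 : K 1.
  rewrite -[1](subKr (b * a)); apply: (additive_subgroupD (left_ideal_additive sS lK)).
    by apply: KM => //; exact: skew_mem_base.
  by apply: (additive_subgroupN (left_ideal_additive sS lK)); apply: JK.
apply/seteqP; split=> // c Sc; rewrite -[c]mulr1; exact: KM.
Qed.

(** Ideal powers allow finite sums only. So, from right to left, the tail of the series is gathered
    into a single product [t * x ^+ N], with [t] the shifted series, and the finitely many terms of
    index [j < N] have coefficients in the power [N - j] of [m]. *)
Lemma skew_ideal_pow N :
  ideal_pow S mS N = skew_filtration S coef (ideal_pow B m) 1 N.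
Proof.
apply/seteqP; split=> r.
  elim: N r => [|N IH] r; first by split=> // j; exact: coef_mem.
  apply: ideal_mul_ind => [|a b /skew_maximal_ideal[Sa ma] /IH Gb].
    exact: skew_filt_additive.
  apply: (@skew_filtM _ 1 filtm sgm dlm 1 N) => //; split=> // -[|j].
    by rewrite muln0 ideal_pow1.
  by rewrite mul1n; exact: coef_mem.
move=> [Sr mr].
have mx : mS x.
  apply/skew_maximal_ideal; split; first exact: skew_mem_var.
  have [_] := coef_mon 1 B1; rewrite expr1 mul1r => -> /=.
  by case: idm => _ [].
have mSm b : m b -> mS b.
  move=> mb; have Bb : B b by case: idm => + _ _ _; apply.
  by apply/skew_maximal_ideal; split; [exact: skew_mem_base | rewrite coef_base].
have powm M b : ideal_pow B m M b -> ideal_pow S mS M b.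
  elim: M b => [|M IH] b; first exact: skew_mem_base.
  apply: ideal_mul_ind => [|a c ma pc]; first exact: ideal_pow_additive.
  by apply: ideal_mul_mem; [exact: mSm | exact: IH].
have [t St ct] : exists2 t, S t & forall j, coef t j = coef r (j + N).
  have [_ _ surj] := coef_bij.
  have [|t St ct] := surj (fun j => coef r (j + N)); first by move=> j; exact: coef_mem.
  by exists t => // j; rewrite ct.
have StX : S (t * x ^+ N) by apply: SM.
have -> : r = skew_trunc r N + t * x ^+ N.
  have Str := skew_trunc_mem N Sr.
  apply: coef_inj => // [|j]; first exact: additive_subgroupD.
  rewrite skew_coefD // coef_trunc // coef_mulX // ct.
  by case: ltnP => jN; rewrite ?addr0 // subnK // add0r.
have addp := ideal_pow_additive sS idmS N.
apply: (additive_subgroupD addp); last first.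
  by apply: (@ideal_powM _ _ _ sS idmS 0) => //; exact: ideal_powX.
apply: (additive_subgroup_sum addp) => j; rewrite mem_index_iota => /andP[_ jN] _.
rewrite -(subnK (ltnW jN)); apply: (ideal_powM sS idmS).
  by apply: powm; have := mr j; rewrite mul1n.
exact: ideal_powX.
Qed.

Lemma skew_trunc_close r N : S r -> ideal_pow S mS N (r - skew_trunc r N).
Proof.
move=> Sr; have St := skew_trunc_mem N Sr; rewrite skew_ideal_pow.
split=> [|j]; first exact: SB.
rewrite skew_coefB // coef_trunc //; case: ltnP => jN.
  by rewrite subrr; exact: filt_zero filtm _.
by rewrite mul1n (eqP jN) subr0; exact: coef_mem.
Qed.

Lemma skew_ideal_pow_base N b :
  B b -> ideal_pow S mS N b <-> ideal_pow B m N b.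
Proof.
move=> Bb; rewrite skew_ideal_pow; split=> [[_ /(_ 0%N)]|mb].
  by rewrite muln0 subn0 coef_base.
split=> [|j]; first exact: skew_mem_base.
rewrite coef_base //; case: eqP => [->|_]; first by rewrite muln0 subn0.
exact: filt_zero filtm _.
Qed.

Lemma skew_filtrationP F e : filtration B m F ->
  (forall d r, F d r -> F d (sg r)) -> (forall d r, F d r -> F (d + e)%N (dl r)) ->
  filtration S mS (skew_filtration S coef F e).
Proof.
move=> filtF sgF dlF; split.
- apply/seteqP; split=> [r []//|r Sr]; split=> // j.
  by rewrite sub0n (filt0 filtF); exact: coef_mem.
- by move=> d; apply: skew_filt_additive.
- by move=> d; apply: skew_filt_le filtF _ _ _.
- by move=> c d r s; apply: skew_filtM.
- move=> d r Sr cl; split=> // j; apply: (filt_closed filtF); first exact: coef_mem.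
  (* An element of the power [N + j] of [mS] has its [j]-th coefficient in the power [N] of [m],
     whence the shift. *)
  move=> N; have [g [Sg Fg]] := cl (N + j)%N; rewrite skew_ideal_pow => -[_ /(_ j)].
  by rewrite mul1n addnK skew_coefB // => H; exists (coef g j).
Qed.

End SkewStep.

(** * Weight filtrations on the tower *)

Definition additive_on (R : nzRingType) (B : set R) (f : R -> R) : Prop :=
  forall a b, B a -> B b -> f (a + b) = f a + f b.

Section AdditiveMaps.
Variables (R : nzRingType) (B : set R) (f : R -> R).
Hypotheses (addB : additive_subgroup B) (addf : additive_on B f).

Lemma additive_on0 : f 0 = 0.
Proof.
have B0 : B 0 by case: addB.
by apply: (addrI (f 0)); rewrite addr0 -addf // addr0.
Qed.

Lemma additive_onB a b : B a -> B b -> f (a - b) = f a - f b.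
Proof.
move=> Ba Bb; apply: (addIr (f b)); rewrite -addf ?subrK //.
by case: addB => _; apply.
Qed.

Lemma additive_on_sum (I : eqType) (t : seq I) (g : I -> R) :
  (forall i, i \in t -> B (g i)) ->
  f (\sum_(i <- t) g i) = \sum_(i <- t) f (g i).
Proof.
elim: t => [|i t IH] Bg; first by rewrite !big_nil additive_on0.
have Bg' j : j \in t -> B (g j) by move=> jt; apply: Bg; rewrite inE jt orbT.
rewrite !big_cons addf ?IH //; first by apply: Bg; rewrite inE eqxx.
by apply: additive_subgroup_sum => // j /Bg'.
Qed.

End AdditiveMaps.

(** [triangular_tower] with levels indexed by natural numbers and the coefficient maps chosen once,
    so that constructions can recurse on the level. *)
Record skew_tower (R : nzRingType) (n s : nat) (Rs m : nat -> set R)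
    (x : nat -> R) (sg dl : nat -> R -> R) (coef : nat -> R -> nat -> R)
    : Prop := SkewTower {
  tower_le : (s <= n)%N;
  tower_top : Rs n = setT;
  tower_local : forall i, (s <= i <= n)%N -> complete_local (Rs i) (m i);
  tower_lsd : forall i, (s <= i < n)%N ->
    local_skew_derivation (Rs i) (m i) (sg i) (dl i);
  tower_linear : forall i, (s <= i < n)%N -> linear_over (Rs s) (sg i) (dl i);
  tower_triangular : forall i j, (s <= j <= i)%N -> (i < n)%N ->
    skew_derivation (Rs j) (sg i) (dl i);
  tower_coef : forall i, (s <= i < n)%N ->
    skew_coefficients (Rs i) (m i) (Rs i.+1) (x i) (sg i) (dl i) (coef i) }.

(* [weight_filtration l i d] consists of the elements of [Rs i] all of whose
   monomials have degree at least [d] in the first [l] variables of the tower;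
   it is the closed ideal generated by the [d]-th power of the maximal ideal of
   [Rs l] when [l <= i], and the [d]-th power of that of [Rs i] otherwise. *)
Fixpoint weight_filtration (R : nzRingType) (s : nat) (Rs m : nat -> set R)
    (coef : nat -> R -> nat -> R) (l i d : nat) : set R :=
  if (i <= s)%N then ideal_pow (Rs s) (m s) d else
  if i is i'.+1 then
    skew_filtration (Rs i) (coef i')
      (weight_filtration s Rs m coef l i') (i' < l)%N d
  else set0.

Section Tower.
Variables (R : nzRingType) (n s : nat) (Rs m : nat -> set R).
Variables (x : nat -> R) (sg dl : nat -> R -> R) (coef : nat -> R -> nat -> R).
Hypothesis tw : skew_tower n s Rs m x sg dl coef.

Local Notation V := (weight_filtration s Rs m coef).

Let tower_le_n i : (s <= i < n)%N -> (s <= i <= n)%N. Proof. lia. Qed.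
Let tower_lt_n i : (s <= i < n)%N -> (s <= i.+1 <= n)%N. Proof. lia. Qed.

Lemma tower_ind (P : nat -> Prop) : P s ->
  (forall i, (s <= i < n)%N -> P i -> P i.+1) ->
  forall i, (s <= i <= n)%N -> P i.
Proof.
move=> Ps IH i; elim: i => [|i IHi] sin; first by have <- : s = 0%N by lia.
have [<- //|ne] := eqVneq s i.+1.
by apply: IH; [lia | apply: IHi; lia].
Qed.

Lemma tower_subring i : (s <= i <= n)%N -> subring (Rs i).
Proof. by case/(tower_local tw) => -[]. Qed.

Lemma tower_ideal i : (s <= i <= n)%N -> two_sided_ideal (Rs i) (m i).
Proof. by case/(tower_local tw) => /local_two_sided. Qed.

Lemma tower_sub i j : (s <= i <= j)%N -> (j <= n)%N -> Rs i `<=` Rs j.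
Proof.
move=> /andP[si /subnK <-]; elim: (j - i)%N => [|k IH] kn r Rr //.
have sk : (s <= k + i < n)%N by lia.
rewrite addSn; apply: (skew_mem_base (tower_coef tw sk)).
by apply: IH => //; lia.
Qed.

Lemma tower_ideal_pow i j N r : (s <= i <= j)%N -> (j <= n)%N -> Rs i r ->
  ideal_pow (Rs j) (m j) N r <-> ideal_pow (Rs i) (m i) N r.
Proof.
move=> /andP[si /subnK <-]; elim: (j - i)%N => [|k IH] kn Rr //.
have sk : (s <= k + i < n)%N by lia.
rewrite addSn.
have H := skew_ideal_pow_base (tower_local tw (tower_le_n sk))
  (tower_local tw (tower_lt_n sk)) (tower_lsd tw sk) (tower_coef tw sk).
rewrite H; first by apply: IH => //; lia.
by apply: (@tower_sub i) => //; lia.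
Qed.

Lemma weight_filtration_base l : V l s = ideal_pow (Rs s) (m s).
Proof. by case: (s) => [//|k]; apply/funext => d /=; rewrite ltnSn. Qed.

Lemma weight_filtrationS l i : (s <= i)%N ->
  V l i.+1 = skew_filtration (Rs i.+1) (coef i) (V l i) (i < l)%N.
Proof. by move=> si; apply/funext => d /=; rewrite ltnNge si. Qed.

Lemma weight_filtration_pow l i : (s <= i <= n)%N -> (i <= l)%N ->
  V l i = ideal_pow (Rs i) (m i).
Proof.
move: i; apply: tower_ind => [|i sin IH] il; first exact: weight_filtration_base.
apply/funext => d; rewrite weight_filtrationS; last by lia.
rewrite IH ?(ltnW il) // il.
by rewrite (skew_ideal_pow (tower_local tw (tower_le_n sin))
  (tower_local tw (tower_lt_n sin)) (tower_lsd tw sin) (tower_coef tw sin)).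
Qed.

(** Locality is given on [Rs j]. Triangularity keeps the images inside [Rs i], and the powers of
    [m j] meet [Rs i] in those of [m i], so locality descends. *)
Lemma tower_pow_stable i j d r : (s <= i <= j)%N -> (j < n)%N ->
  ideal_pow (Rs i) (m i) d r ->
  ideal_pow (Rs i) (m i) d (sg j r) /\ ideal_pow (Rs i) (m i) d.+1 (dl j r).
Proof.
move=> sij jn mr; have sj : (s <= j < n)%N by lia.
have sin : (s <= i <= n)%N by lia.
have Rr := ideal_pow_sub (tower_subring sin) (tower_ideal sin) mr.
have [[bij _ _ _] dlR _ _] := tower_triangular tw sij jn.
have mjr : ideal_pow (Rs j) (m j) d r by apply/(@tower_ideal_pow i) => //; lia.
have [_ sgN dlN] := tower_lsd tw sj.
case: bij => sgR _ _; split.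
  apply/(@tower_ideal_pow i j) => //; [lia|exact: sgR|].
  by rewrite -sgN; exists r.
by apply/(@tower_ideal_pow i j) => //; [lia|exact: dlR|apply: dlN; exists r].
Qed.

Lemma weight_filtration_stepsub l i d r : (s <= i < n)%N ->
  filtration (Rs i) (m i) (V l i) -> V l i d r -> V l i.+1 d r.
Proof.
move=> sin filt Vr; rewrite weight_filtrationS; last by lia.
rewrite -[r]mulr1 -(expr0 (x i)).
by apply: (skew_filt_mon (tower_coef tw sin) filt _ Vr); lia.
Qed.

(** The filtration at level [i.+1] needs stability under [sg i] and [dl i] at level [i], while
    stability at level [i.+1] needs closedness there; hence a joint induction. The gain [j < l] of
    [dl j] equals the weight of [x j], as the next skew step requires. *)
Lemma weight_filtrationP l i : (s <= l)%N -> (s <= i <= n)%N ->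
  filtration (Rs i) (m i) (V l i) /\
  forall j, (i <= j < n)%N -> forall d r, V l i d r ->
    V l i d (sg j r) /\ V l i (d + (j < l))%N (dl j r).
Proof.
move=> sl; move: i; apply: tower_ind => [|i sin [filt stab]].
  have ss : (s <= s <= n)%N by have := tower_le tw; lia.
  have := ideal_pow_filtration (tower_subring ss) (tower_ideal ss).
  rewrite weight_filtration_base => filt; split=> // j sj d r mr.
  have sij : (s <= s <= j)%N by lia.
  have jn : (j < n)%N by lia.
  have [sgr dlr] := tower_pow_stable sij jn mr.
  by split=> //; apply: (filt_le filt) dlr; lia.
have si : (s <= i)%N by lia.
have cli := tower_local tw (tower_le_n sin).
have clS := tower_local tw (tower_lt_n sin).
have lsd := tower_lsd tw sin; have cP := tower_coef tw sin.
have filtS : filtration (Rs i.+1) (m i.+1) (V l i.+1).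
  rewrite weight_filtrationS //.
  apply: (skew_filtrationP cli clS lsd cP filt) => d r /(stab i);
    by rewrite leqnn; case/andP: sin => _ -> /(_ isT)[].
split=> // j ij d r Vr.
have sij : (s <= i.+1 <= j)%N by lia.
have jn : (j < n)%N by lia.
(* If [i < l], the filtration is by powers of [m i.+1], which [dl j] raises by one. Otherwise [x i]
   and [x j] have weight 0, and no gain is asked of [dl j]. *)
have [il|il] := ltnP i l.
  move: Vr; have sS := tower_lt_n sin.
  rewrite !(weight_filtration_pow sS il) => mr.
  have [sgr dlr] := tower_pow_stable sij jn mr.
  split=> //; apply: ideal_pow_le dlr; [exact: tower_subring|exact: tower_ideal|lia].
have jl : (j < l)%N = false by lia.
rewrite jl addn0.
have [[bij sg1 sgD sgM] dlR dlD dlM] := tower_triangular tw sij jn.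
have sgR : set_fun (Rs i.+1) (Rs i.+1) (sg j) by case: bij.
have sS := tower_lt_n sin.
have addS := subring_additive (tower_subring sS).
have RX t : Rs i.+1 (x i ^+ t).
  by apply: subringX (tower_subring sS) _;  apply: (skew_mem_var cli cP).
have [Sr Vc] : skew_filtration (Rs i.+1) (coef i) (V l i) false d r.
  by move: Vr; rewrite weight_filtrationS // ltnNge il.
have Vcoef t : V l i d (coef i r t).
  by have := Vc t; rewrite mul0n subn0.
have Rc t : Rs i.+1 (coef i r t).
  by apply: (skew_mem_base cP) (filt_sub filt (Vcoef t)).
have RcX t : Rs i.+1 (coef i r t * x i ^+ t).
  by case: (tower_subring sS) => _ _; apply.
have close N := skew_trunc_close cli clS lsd cP N Sr.
have St N := skew_trunc_mem clS cP N Sr.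
have stabc t : V l i d (sg j (coef i r t)) /\ V l i d (dl j (coef i r t)).
  have ijn : (i <= j < n)%N by lia.
  by have := stab j ijn d _ (Vcoef t); rewrite jl addn0.
(* The maps are applied to truncations, whose coefficients lie in [V l i d]; the images of the tails
   are small because ideal powers are stable. *)
split; apply: (filt_closed filtS); [exact: sgR| |exact: dlR|] => N.
  exists (sg j (skew_trunc (x i) (coef i) r N)); last first.
    rewrite -(additive_onB addS sgD) //.
    by have [] := tower_pow_stable sij jn (close N).
  rewrite (additive_on_sum addS sgD) //.
  apply: (additive_subgroup_sum (filt_additive filtS d)) => t _ _.
  rewrite sgM //; apply: (filtMr filtS); last exact: sgR.
  by apply: weight_filtration_stepsub => //; case: (stabc t).
exists (dl j (skew_trunc (x i) (coef i) r N)); last first.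
  rewrite -(additive_onB addS dlD) //.
  have [_] := tower_pow_stable sij jn (close N).
  exact: ideal_powS_sub (tower_subring sS) (tower_ideal sS) _ _.
rewrite (additive_on_sum addS dlD) //.
apply: (additive_subgroup_sum (filt_additive filtS d)) => t _ _.
rewrite dlM //; apply: (additive_subgroupD (filt_additive filtS d)).
  apply: (filtMr filtS) => //.
  by apply: weight_filtration_stepsub => //; case: (stabc t).
apply: (filtMr filtS); last exact: dlR.
by apply: weight_filtration_stepsub => //; case: (stabc t).
Qed.

Lemma weight_filtration_filt l i : (s <= l)%N -> (s <= i <= n)%N ->
  filtration (Rs i) (m i) (V l i).
Proof. by move=> sl sin; case: (weight_filtrationP sl sin). Qed.

Lemma weight_filtration_sub l i j d : (s <= l)%N -> (s <= i <= j)%N ->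
  (j <= n)%N -> V l i d `<=` V l j d.
Proof.
move=> sl /andP[si /subnK <-]; elim: (j - i)%N => [|k IH] kn r Vr //.
have sk : (s <= k + i < n)%N by lia.
rewrite addSn; apply: weight_filtration_stepsub => //.
  by apply: weight_filtration_filt => //; lia.
by apply: IH => //; lia.
Qed.

End Tower.

(** * Digits and expansions *)

Definition exponent (n : nat) (alpha : 'rV[nat]_n) (t : nat) : nat :=
  if insub t is Some i then alpha 0 i else 0%N.

Lemma exponent_ord (n : nat) (alpha : 'rV[nat]_n) (i : 'I_n) :
  exponent alpha i = alpha 0 i.
Proof. by rewrite /exponent valK. Qed.

Lemma exponent_inj (n : nat) (alpha beta : 'rV[nat]_n) :
  (forall t, (t < n)%N -> exponent alpha t = exponent beta t) -> alpha = beta.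
Proof. by move=> e; apply/rowP => i; rewrite -!exponent_ord; apply: e. Qed.

Lemma exponentD (n : nat) (alpha beta : 'rV[nat]_n) t :
  exponent (alpha + beta) t = (exponent alpha t + exponent beta t)%N.
Proof. by rewrite /exponent; case: insubP => // i _ _; rewrite mxE. Qed.

Definition ordered_monomial (R : nzRingType) (x : nat -> R) (i : nat)
    (a : nat -> nat) : R := \prod_(0 <= t < i) x t ^+ a t.

Definition weight (l i : nat) (a : nat -> nat) : nat :=
  \sum_(0 <= t < i) (t < l)%N * a t.

Lemma weightS l i a : weight l i.+1 a = (weight l i a + (i < l) * a i)%N.
Proof. by rewrite /weight big_nat_recr. Qed.

Lemma weightD l i a b :
  weight l i (fun t => a t + b t)%N = (weight l i a + weight l i b)%N.
Proof. by rewrite /weight -big_split; apply: eq_bigr => t _; rewrite mulnDr. Qed.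

Lemma eq_weight l i a b : (forall t, (t < i)%N -> a t = b t) ->
  weight l i a = weight l i b.
Proof.
by move=> e; apply: eq_big_nat => t /andP[_ ti]; rewrite e.
Qed.

Lemma exponent_le_weight n (alpha : 'rV[nat]_n) i :
  (alpha 0%R i <= weight n n (exponent alpha))%N.
Proof.
rewrite /weight big_mkord (bigD1 i) //= ltn_ord mul1n exponent_ord.
exact: leq_addr.
Qed.

(** A common interface to both base rings: [s = 0] for a field, and [s = 1] for a valuation ring,
    whose uniformiser is the one variable below [s]. Digits are governed by congruences, as [iota]
    need not be additive. *)
Record base_digits (R : nzRingType) (k : finFieldType) (n s : nat)
    (Rs m : nat -> set R) (x : nat -> R) (iota : k -> R)
    (dg : R -> (nat -> nat) -> k) : Prop := BaseDigits {
  base_iota0 : iota 0 = 0;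
  base_iota1 : iota 1 = 1;
  base_iotaM : {morph iota : a b / a * b};
  base_iota_inj : injective iota;
  base_iota_mem : forall c, Rs s (iota c);
  base_comm : forall a b, Rs s a -> Rs s b -> a * b = b * a;
  base_var : forall t, (t < s)%N -> m s (x t);
  base_digit_cong : forall d r r', Rs s r -> Rs s r' ->
    ideal_pow (Rs s) (m s) d (r - r') <->
    forall a, (\sum_(0 <= t < s) a t < d)%N -> dg r a = dg r' a;
  base_digit_ext : forall r a a',
    (forall t, (t < s)%N -> a t = a' t) -> dg r a = dg r a';
  base_digit_sum : forall (D : seq 'rV[nat]_n) (c : 'rV[nat]_n -> k) gamma,
    uniq D -> (forall alpha, alpha \in D -> forall t, (s <= t)%N ->
      exponent alpha t = exponent gamma t) ->
    dg (\sum_(alpha <- D) iota (c alpha) * ordered_monomial x s (exponent alpha))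
      (exponent gamma) = if gamma \in D then c gamma else 0 }.

(** Monomials end with their last variable and coefficients stand on the left, so the last exponent
    is stripped first, down to an element of the base. *)
Fixpoint digit (R : nzRingType) (k : finFieldType) (s : nat)
    (coef : nat -> R -> nat -> R) (dg : R -> (nat -> nat) -> k)
    (i : nat) (r : R) (a : nat -> nat) : k :=
  if (i <= s)%N then dg r a else
  if i is i'.+1 then digit s coef dg i' (coef i' r (a i')) a else 0.

Section Digits.
Variables (R : nzRingType) (k : finFieldType) (n s : nat) (Rs m : nat -> set R).
Variables (x : nat -> R) (sg dl : nat -> R -> R) (coef : nat -> R -> nat -> R).
Variables (iota : k -> R) (dg : R -> (nat -> nat) -> k).
Hypothesis tw : skew_tower n s Rs m x sg dl coef.
Hypothesis bd : base_digits n s Rs m x iota dg.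

Local Notation V := (weight_filtration s Rs m coef).
Local Notation C := (digit s coef dg).
Local Notation mon i alpha := (ordered_monomial x i (exponent alpha)).

Let tower_le_n i : (s <= i < n)%N -> (s <= i <= n)%N. Proof. lia. Qed.
Let tower_lt_n i : (s <= i < n)%N -> (s <= i.+1 <= n)%N. Proof. lia. Qed.

Lemma digit_base : C s = dg.
Proof. by case: (s) => [|j] //=; apply/funext => r; apply/funext => a; rewrite ltnSn. Qed.

Lemma digitS i r a : (s <= i)%N -> C i.+1 r a = C i (coef i r (a i)) a.
Proof. by move=> si /=; rewrite ltnNge si. Qed.

Lemma digit_ext i r a a' : (s <= i <= n)%N ->
  (forall t, (t < i)%N -> a t = a' t) -> C i r a = C i r a'.
Proof.
move=> sin; move: i sin r; apply: tower_ind => [|i sin IH] r e.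
  by rewrite digit_base; apply: (base_digit_ext bd).
rewrite !digitS; try lia.
by rewrite e //; apply: IH => t ti; apply: e; rewrite ltnW.
Qed.

(** The coefficient maps are additive although the digits are not; the difference can thus be pushed
    down through the coefficients to the base, where [base_digit_cong] compares two elements. *)
Lemma digit_cong l i : (s <= l)%N -> (s <= i <= n)%N -> forall d r r',
  Rs i r -> Rs i r' ->
  V l i d (r - r') <-> forall a, (weight l i a < d)%N -> C i r a = C i r' a.
Proof.
move=> sl; move: i; apply: tower_ind => [|i sin IH] d r r' Rr Rr'.
  rewrite weight_filtration_base digit_base (base_digit_cong bd) //.
  have e a : weight l s a = (\sum_(0 <= t < s) a t)%N.
    apply: eq_big_nat => t /andP[_ ts]; have -> : (t < l)%N by lia.
    by rewrite mul1n.
  by split=> H a; [rewrite e|rewrite -e]; apply: H.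
have cl := tower_local tw (tower_le_n sin); have cP := tower_coef tw sin.
have si : (s <= i)%N by lia.
have cR j := coef_mem cP j Rr; have cR' j := coef_mem cP j Rr'.
rewrite weight_filtrationS //; split.
  move=> [_ Vc] a wa; rewrite !digitS //.
  move: {Vc}(Vc (a i)); rewrite (skew_coefB cl cP) // IH //; apply.
  by move: wa; rewrite weightS; lia.
move=> H; split=> [|j].
  have [_ +] := subring_additive (tower_subring tw (tower_lt_n sin)); exact.
rewrite (skew_coefB cl cP) // IH // => a wa.
(* Digits at level [i] ignore entry [i], which is therefore free to select the coefficient of index
   [j]. *)
pose a' t := if t == i then j else a t.
have ea t : (t < i)%N -> a t = a' t by move=> ti; rewrite /a' ltn_eqF.
rewrite !(digit_ext _ (tower_le_n sin) ea).
have := H a'; rewrite weightS -(eq_weight _ ea) !digitS // /a' eqxx; apply.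
by move: wa; lia.
Qed.

Lemma ordered_monomialS i a :
  ordered_monomial x i.+1 a = ordered_monomial x i a * x i ^+ a i.
Proof. by rewrite /ordered_monomial big_nat_recr. Qed.

Lemma ordered_monomial_mem i a : (s <= i <= n)%N -> Rs i (ordered_monomial x i a).
Proof.
move: i; apply: tower_ind => [|i sin IH].
  have ss : (s <= s <= n)%N by have := tower_le tw; lia.
  have sR := tower_subring tw ss; have [R1 _ RM] := sR.
  rewrite /ordered_monomial big_nat; apply: big_ind => // t ts.
  apply: subringX => //; have [mR _ _ _] := tower_ideal tw ss.
  by apply: mR; apply: (base_var bd); lia.
by rewrite ordered_monomialS; apply: (skew_mem_mon (tower_coef tw sin)).
Qed.

Lemma digit_term_mem i c a : (s <= i <= n)%N ->
  Rs i (iota c * ordered_monomial x i a).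
Proof.
move=> sin; have [_ _] := tower_subring tw sin; apply.
  by apply: (@tower_sub _ _ _ _ _ _ _ _ _ tw s); [lia|lia|apply: (base_iota_mem bd)].
exact: ordered_monomial_mem.
Qed.

(** Vectors that agree with [gamma] from [i] on and are distinct differ below [i], so no monomial of
    [Rs i] occurs twice; a repetition would require adding elements of iota(k), which may leave
    it. *)
Lemma digit_sum i (D : seq 'rV[nat]_n) (c : 'rV[nat]_n -> k) gamma :
  (s <= i <= n)%N -> uniq D ->
  (forall alpha, alpha \in D -> forall t, (i <= t)%N ->
     exponent alpha t = exponent gamma t) ->
  C i (\sum_(alpha <- D) iota (c alpha) * mon i alpha) (exponent gamma) =
    if gamma \in D then c gamma else 0.
Proof.
move=> sin; move: i sin D; apply: tower_ind => [|i sin IH] D uD eD.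
  by rewrite digit_base (base_digit_sum bd).
have cl := tower_local tw (tower_le_n sin).
have clS := tower_local tw (tower_lt_n sin); have cP := tower_coef tw sin.
rewrite digitS; last by lia.
rewrite (skew_coef_sum cl clS cP) => [|alpha _]; last exact: digit_term_mem (tower_lt_n sin).
have -> : \sum_(alpha <- D) coef i (iota (c alpha) * mon i.+1 alpha) (exponent gamma i)
  = \sum_(alpha <- [seq alpha <- D | exponent alpha i == exponent gamma i])
      iota (c alpha) * mon i alpha.
  rewrite big_filter [RHS]big_mkcond; apply: eq_bigr => alpha _.
  rewrite ordered_monomialS mulrA (coef_monE cP); first by rewrite eq_sym.
  exact: digit_term_mem (tower_le_n sin).
rewrite IH ?filter_uniq // => [|alpha]; first by rewrite mem_filter eqxx.
rewrite mem_filter => /andP[/eqP ei aD] t; rewrite leq_eqVlt => /orP[/eqP<- //|].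
exact: eD.
Qed.

End Digits.

(** * Expansions and supports read off from digits *)

Section Expansions.
Variables (R : nzRingType) (k : finFieldType) (n s : nat) (Rs m : nat -> set R).
Variables (x : nat -> R) (sg dl : nat -> R -> R) (coef : nat -> R -> nat -> R).
Variables (iota : k -> R) (dg : R -> (nat -> nat) -> k) (y : 'I_n -> R).
Hypothesis tw : skew_tower n s Rs m x sg dl coef.
Hypothesis bd : base_digits n s Rs m x iota dg.
Hypothesis xy : forall i : 'I_n, x i = y i.

Local Notation V := (weight_filtration s Rs m coef).
Local Notation C := (digit s coef dg).

Let snn : (s <= n <= n)%N. Proof. by have := tower_le tw; lia. Qed.
Let Rn r : Rs n r. Proof. by rewrite (tower_top tw). Qed.
Let Vpow : V n n = ideal_pow (Rs n) (m n).
Proof. exact: (weight_filtration_pow tw snn). Qed.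

Lemma monomialE alpha :
  monomial y alpha = ordered_monomial x n (exponent alpha).
Proof.
rewrite /monomial /ordered_monomial big_mkord; apply: eq_bigr => i _.
by rewrite exponent_ord xy.
Qed.

Definition degree_below N : {fset 'rV[nat]_n} :=
  [fset alpha in [seq \row_i nat_of_ord (f i)
    | f : {ffun 'I_n -> 'I_N.+1} <- enum {ffun 'I_n -> 'I_N.+1}]]%fset.

Lemma mem_degree_below N alpha :
  (weight n n (exponent alpha) < N)%N -> alpha \in degree_below N.
Proof.
move=> wN; rewrite in_fset; apply/mapP.
exists [ffun i => inord (alpha 0 i)]; first by rewrite mem_enum.
apply/rowP => i; rewrite mxE ffunE inordK // ltnS ltnW //.
exact: leq_ltn_trans (exponent_le_weight alpha i) wN.
Qed.

Lemma sum_monomialE (D : seq 'rV[nat]_n) (c : 'rV[nat]_n -> k) :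
  \sum_(alpha <- D) iota (c alpha) * monomial y alpha =
  \sum_(alpha <- D) iota (c alpha) * ordered_monomial x n (exponent alpha).
Proof. by apply: eq_bigr => alpha _; rewrite monomialE. Qed.

Let digit_sum_n (D : seq 'rV[nat]_n) (c : 'rV[nat]_n -> k) gamma : uniq D ->
  C n (\sum_(alpha <- D) iota (c alpha) * monomial y alpha) (exponent gamma) =
    if gamma \in D then c gamma else 0.
Proof.
move=> uD; rewrite sum_monomialE (digit_sum tw bd) // => alpha _ t nt.
by rewrite /exponent insubF // ltnNge nt.
Qed.

Lemma digit_monomial alpha : C n (monomial y alpha) (exponent alpha) = 1.
Proof.
have := @digit_sum_n [:: alpha] (fun=> 1) alpha isT.
by rewrite big_seq1 (base_iota1 bd) mul1r inE eqxx.
Qed.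

Lemma digit0 (alpha : 'rV[nat]_n) : C n 0 (exponent alpha) = 0.
Proof. by have := @digit_sum_n [::] (fun=> 1) alpha isT; rewrite big_nil. Qed.

(** By [digit_cong] with [l = n], closeness to order [N] means agreement of the digits of degree
    below [N], and every finite set containing [degree_below N] achieves it. *)
Lemma digit_expansion r :
  expansion Rs m y iota r (fun alpha => iota (C n r (exponent alpha))).
Proof.
split=> [alpha|N]; first by exists (C n r (exponent alpha)).
exists (degree_below N) => D /fsubsetP D0D.
have sn : (s <= n)%N by case/andP: snn.
rewrite -Vpow; apply/(digit_cong tw bd) => // a wa.
pose gamma : 'rV[nat]_n := \row_i a i.
have ea t : (t < n)%N -> a t = exponent gamma t.
  by move=> tn; rewrite -[t]/(val (Ordinal tn)) exponent_ord mxE.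
rewrite !(digit_ext coef bd _ snn ea) digit_sum_n ?fset_uniq // D0D //.
by apply: mem_degree_below; rewrite -(eq_weight _ ea).
Qed.

Lemma expansion_unique r c alpha :
  expansion Rs m y iota r c -> c alpha = iota (C n r (exponent alpha)).
Proof.
(* Precision one above the degree of [alpha] determines its digit; adjoining [alpha] to [D0] makes
   [c alpha] occur in the partial sum. *)
move=> [cR clim]; have [D0 HD] := clim (weight n n (exponent alpha)).+1.
have sn : (s <= n)%N by case/andP: snn.
have [f cf] : exists f : 'rV[nat]_n -> k, c = iota \o f.
  have /choice [f fc] : forall a, exists b, iota b = c a.
    by move=> a; case: (cR a) => b _ <-; exists b.
  by exists f; apply/funext => a /=.
have := HD (alpha |` D0)%fset (fsubsetUr _ _); rewrite -Vpow cf.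
move/(digit_cong tw bd sn snn) => /(_ (Rn _) (Rn _) (exponent alpha) (ltnSn _)) ->.
by rewrite digit_sum_n ?fset_uniq // !inE eqxx.
Qed.

Lemma suppP r alpha :
  supp Rs m y iota r alpha <-> C n r (exponent alpha) != 0.
Proof.
have iota_eq0 c : (iota c == 0) = (c == 0).
  by rewrite -(base_iota0 bd) (inj_eq (base_iota_inj bd)).
split=> [[c ec]|nz]; first by rewrite (expansion_unique _ ec) iota_eq0.
exists (fun alpha => iota (C n r (exponent alpha))); last by rewrite iota_eq0.
exact: digit_expansion.
Qed.

(** Multiplicativity of [iota] keeps the coefficients in iota(k), so [iota c] times an expansion is
    again an expansion, and uniqueness applies. *)
Lemma digit_scale c r (alpha : 'rV[nat]_n) :
  C n (iota c * r) (exponent alpha) = c * C n r (exponent alpha).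
Proof.
apply: (base_iota_inj bd); rewrite (base_iotaM bd); symmetry.
suff : expansion Rs m y iota (iota c * r)
         (fun alpha => iota c * iota (C n r (exponent alpha))).
  by move/(expansion_unique alpha).
have [dR dlim] := digit_expansion r; split=> [a|N].
  by exists (c * C n r (exponent a)); rewrite // (base_iotaM bd).
have [D0 HD] := dlim N; exists D0 => D /HD H.
under eq_bigr do rewrite -mulrA.
rewrite -mulr_sumr -mulrBr.
apply: (@ideal_powM _ _ _ (tower_subring tw snn) (tower_ideal tw snn) 0) => //.
Qed.

End Expansions.

(** * Products modulo higher terms *)

Section LeadingTerms.
Variables (R : nzRingType) (k : finFieldType) (n s : nat) (Rs m : nat -> set R).
Variables (x : nat -> R) (sg dl : nat -> R -> R) (coef : nat -> R -> nat -> R).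
Variables (iota : k -> R) (dg : R -> (nat -> nat) -> k).
Hypothesis tw : skew_tower n s Rs m x sg dl coef.
Hypothesis bd : base_digits n s Rs m x iota dg.

Local Notation V := (weight_filtration s Rs m coef).
Local Notation C := (digit s coef dg).
Local Notation mon := (ordered_monomial x).

Implicit Types (f g : nat -> nat) (r q : R).

Let snn : (s <= n <= n)%N. Proof. by have := tower_le tw; lia. Qed.
Let Rn r : Rs n r. Proof. by rewrite (tower_top tw). Qed.

Let filtn l : (s <= l)%N -> filtration (Rs n) (m n) (V l n).
Proof. by move=> sl; apply: (weight_filtration_filt tw). Qed.

Definition multi_filtration f r : Prop :=
  forall l, (s <= l <= n)%N -> V l n (f l) r.

Local Notation VV := multi_filtration.

(* All monomials of such an element have a vector of weights at least [f] and
   different from [f]. *)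
Inductive higher_terms f : R -> Prop :=
| higher_terms0 : higher_terms f 0
| higher_terms_cons l r r' : (s <= l <= n)%N -> VV f r -> V l n (f l).+1 r ->
    higher_terms f r' -> higher_terms f (r + r').

Lemma multi_filtrationM f g r q : VV f r -> VV g q ->
  VV (fun l => f l + g l)%N (r * q).
Proof.
move=> fr gq l sl; have [sl' _] := andP sl.
by apply: (filtM (filtn sl')); [apply: fr|apply: gq].
Qed.

Lemma multi_filtration_trivial r : VV (fun=> 0%N) r.
Proof. by move=> l /andP[sl _]; rewrite (filt0 (filtn sl)). Qed.

Lemma multi_filtrationX f r j : VV f r -> VV (fun l => j * f l)%N (r ^+ j).
Proof.
move=> fr; elim: j => [|j IH]; first exact: multi_filtration_trivial.
by move=> l sl; rewrite exprS mulSn; apply: (multi_filtrationM fr IH).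
Qed.

Lemma higher_termsD f r q :
  higher_terms f r -> higher_terms f q -> higher_terms f (r + q).
Proof.
move=> fr fq; elim: fr => [|l r1 r2 sl fr1 lr1 _ IH]; first by rewrite add0r.
by rewrite -addrA; exact: (higher_terms_cons sl fr1 lr1 IH).
Qed.

Lemma higher_terms_single f l r :
  (s <= l <= n)%N -> VV f r -> V l n (f l).+1 r -> higher_terms f r.
Proof.
move=> sl fr lr; rewrite -[r]addr0.
exact: (higher_terms_cons sl fr lr (higher_terms0 f)).
Qed.

Lemma higher_termsMl f g q r : VV g q -> higher_terms f r ->
  higher_terms (fun l => g l + f l)%N (q * r).
Proof.
move=> gq; elim=> [|l r1 r2 sl fr1 lr1 _ IH].
  by rewrite mulr0; exact: higher_terms0.
rewrite mulrDr; apply: (higher_terms_cons sl) => //; first exact: multi_filtrationM.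
rewrite -addnS; have [sl' _] := andP sl.
by apply: (filtM (filtn sl')) => //; apply: gq.
Qed.

Lemma higher_termsMr f g q r : VV g q -> higher_terms f r ->
  higher_terms (fun l => f l + g l)%N (r * q).
Proof.
move=> gq; elim=> [|l r1 r2 sl fr1 lr1 _ IH].
  by rewrite mul0r; exact: higher_terms0.
rewrite mulrDl; apply: (higher_terms_cons sl) => //; first exact: multi_filtrationM.
rewrite -addSn; have [sl' _] := andP sl.
by apply: (filtM (filtn sl')) => //; apply: gq.
Qed.

(** Each summand is dropped at its own [l]: a congruence modulo [V l n (f l).+1] fixes every digit
    whose [l]-weight is [f l]. *)
Lemma digit_higher_terms f q r a : higher_terms f r ->
  (forall l, (s <= l <= n)%N -> weight l n a = f l) ->
  C n (q + r) a = C n q a.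
Proof.
move=> fr wf; elim: fr => [|l r1 r2 sl fr1 lr1 _ IH]; first by rewrite addr0.
have [sl' _] := andP sl; rewrite addrCA -{}IH.
have := digit_cong tw bd sl' snn (f l).+1 (Rn (r1 + (q + r2))) (Rn (q + r2)).
by rewrite addrK => -[/(_ lr1) + _]; apply; rewrite wf.
Qed.

(** The relation is directed: [c] may be 0 as far as the definition goes, and [r] is the side whose
    digit will be known. *)
Definition scalar_eq f r q : Prop :=
  exists c v, higher_terms f v /\ r = iota c * q + v.

(** Allows the scalar of a [scalar_eq] to be pulled out when multiplying on the left; linearity over
    the base provides it for monomials. *)
Definition centralizes_iota r : Prop := forall c, r * iota c = iota c * r.

Lemma eq_scalar_eq f g r q : f =1 g -> scalar_eq f r q -> scalar_eq g r q.
Proof. by move=> /funext->. Qed.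

Lemma scalar_eq_refl f r : scalar_eq f r r.
Proof.
exists 1, 0; split; first exact: higher_terms0.
by rewrite (base_iota1 bd) mul1r addr0.
Qed.

Lemma scalar_eq_trans f r q t :
  scalar_eq f r q -> scalar_eq f q t -> scalar_eq f r t.
Proof.
move=> [c [v [fv ->]]] [c' [v' [fv' ->]]].
exists (c * c'), (iota c * v' + v); split.
  apply: higher_termsD => //.
  exact: (higher_termsMl (multi_filtration_trivial (iota c)) fv').
by rewrite (base_iotaM bd) mulrDr !mulrA addrA.
Qed.

Lemma scalar_eqMr f g r q t : VV g t -> scalar_eq f r q ->
  scalar_eq (fun l => f l + g l)%N (r * t) (q * t).
Proof.
move=> gt [c [v [fv ->]]]; exists c, (v * t); split; first exact: higher_termsMr.
by rewrite mulrDl mulrA.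
Qed.

Lemma scalar_eqMl f g r q t : VV g t -> centralizes_iota t -> scalar_eq f r q ->
  scalar_eq (fun l => g l + f l)%N (t * r) (t * q).
Proof.
move=> gt ct [c [v [fv ->]]]; exists c, (t * v); split; first exact: higher_termsMl.
by rewrite mulrDr mulrA ct -mulrA.
Qed.

Lemma centralizes_iotaM r q :
  centralizes_iota r -> centralizes_iota q -> centralizes_iota (r * q).
Proof. by move=> cr cq c; rewrite -mulrA cq mulrA cr mulrA. Qed.

Lemma centralizes_iotaX r j : centralizes_iota r -> centralizes_iota (r ^+ j).
Proof.
move=> cr; elim: j => [|j IH]; first by move=> c; rewrite mulr1 mul1r.
by rewrite exprS; apply: centralizes_iotaM.
Qed.

Let mem_base i c : (s <= i <= n)%N -> Rs i (iota c).
Proof.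
move=> sin; apply: (tower_sub tw _ _ (base_iota_mem bd c)); lia.
Qed.

Let base_var_mem t : (t < s)%N -> Rs s (x t).
Proof.
move=> ts; have ss : (s <= s <= n)%N by case/andP: snn => -> _; rewrite leqnn.
by have [+ _ _ _] := tower_ideal tw ss; apply; apply: (base_var bd).
Qed.

Lemma centralizes_iota_var t : (t < n)%N -> centralizes_iota (x t).
Proof.
move=> tn c; have [ts|st] := ltnP t s.
  by apply: (base_comm bd); [exact: base_var_mem|exact: (base_iota_mem bd)].
have stn : (s <= t < n)%N by lia.
have [_ _ _ _ ->] := tower_coef tw stn; last by apply: mem_base; lia.
by have [-> ->] := tower_linear tw stn (base_iota_mem bd c); rewrite addr0.
Qed.

Lemma centralizes_iota_mon i a : (i <= n)%N -> centralizes_iota (mon i a).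
Proof.
elim: i => [|i IH] isn.
  by rewrite /ordered_monomial big_nil => c; rewrite mulr1 mul1r.
rewrite ordered_monomialS; apply: centralizes_iotaM; first by apply: IH; lia.
exact/centralizes_iotaX/centralizes_iota_var.
Qed.

Lemma multi_filtration_var t : (t < n)%N -> VV (fun l => (t < l)%N : nat) (x t).
Proof.
move=> tn l /andP[sl ln]; have [ts|st] := ltnP t s.
  have -> : (t < l)%N by lia.
  apply: (weight_filtration_sub tw (i := s)) => //; first by rewrite leqnn; lia.
  have ss : (s <= s <= n)%N by lia.
  rewrite weight_filtration_base (ideal_pow1 (tower_subring tw ss) (tower_ideal tw ss)).
  exact: (base_var bd).
have stn : (s <= t < n)%N by lia.
have st1 : (s <= t <= n)%N by lia.
apply: (weight_filtration_sub tw (i := t.+1)) => //; first by lia.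
rewrite weight_filtrationS // -[x t]mul1r -[x t]expr1.
have filt := weight_filtration_filt tw sl st1.
apply: (skew_filt_mon (tower_coef tw stn) filt (c := 0)); first by lia.
by rewrite (filt0 filt); have [] := tower_subring tw st1.
Qed.

Lemma multi_filtration_mon i a :
  (i <= n)%N -> VV (fun l => weight l i a) (mon i a).
Proof.
elim: i => [|i IH] isn l sl.
  by rewrite /weight big_nil; apply: multi_filtration_trivial.
rewrite ordered_monomialS weightS mulnC.
have := multi_filtrationX (a i) (multi_filtration_var isn).
by move/(multi_filtrationM (IH (ltnW isn))); apply.
Qed.

(** Congruence modulo the maximal ideal is equality of the digit at exponent 0, so [c] is that digit
    of [b]. *)
Lemma tower_residue i b : (s <= i <= n)%N -> Rs i b ->
  exists c, ideal_pow (Rs i) (m i) 1 (b - iota c).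
Proof.
move=> sin Rb; exists (C i b (fun=> 0%N)).
have [si _] := andP sin.
rewrite -(weight_filtration_pow tw sin (leqnn i)).
apply/(digit_cong tw bd si sin _ Rb (mem_base _ sin)) => a.
rewrite ltnS leqn0 /weight sum_nat_seq_eq0 => /allP a0.
have ea t : (t < i)%N -> a t = exponent (0 : 'rV[nat]_n) t.
  move=> ti; have := a0 t; rewrite mem_index_iota ti => /(_ isT) /=.
  rewrite mul1n /exponent => /eqP->; case: insubP => // u _ _; by rewrite mxE.
have e0 t : (t < i)%N -> 0%N = exponent (0 : 'rV[nat]_n) t.
  by move=> _; rewrite /exponent; case: insubP => // u _ _; rewrite mxE.
rewrite !(digit_ext coef bd _ sin ea) (digit_ext coef bd _ sin e0).
have := digit_sum tw bd (fun=> C i b (exponent (0 : 'rV[nat]_n)))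
  (D := [:: 0]) (gamma := 0) sin isT.
rewrite big_seq1 inE eqxx /ordered_monomial big_nat big1 ?mulr1 => [->//|t ti].
  by move=> alpha; rewrite inE => /eqP->.
by rewrite -e0 //; case/andP: ti.
Qed.

Lemma multi_filtration_ideal_pow t d r : (s <= t <= n)%N ->
  ideal_pow (Rs t) (m t) d r -> forall l, (t <= l <= n)%N -> V l n d r.
Proof.
move=> stn mr l tl; apply: (weight_filtration_sub tw (i := t)); try lia.
by rewrite (weight_filtration_pow tw) //; lia.
Qed.

(* Writing [x t = sigma_i(y)] gives [x t * x i = x i * y - delta_i(y)], where
   [y] is [iota c * x t] up to an element of the maximal ideal of [Rs t] and an
   element of the square of that of [Rs t.+1]. *)
Lemma scalar_eq_vars t i : (t < i)%N -> (s <= i < n)%N ->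
  scalar_eq (fun l => (t < l) + (i < l))%N (x t * x i) (x i * x t).
Proof.
move=> ti sin; have [_ _ _ _ xi_comm] := tower_coef tw sin.
have [ts|st] := ltnP t s.
  rewrite xi_comm; last first.
    by apply: (tower_sub tw _ _ (base_var_mem ts)); lia.
  have [-> ->] := tower_linear tw sin (base_var_mem ts).
  by rewrite addr0; apply: scalar_eq_refl.
have stn : (s <= t < n)%N by lia.
have st1 : (s <= t <= n)%N by lia.
have st2 : (s <= t.+1 <= n)%N by lia.
have si1 : (s <= i <= n)%N by lia.
have sti : (s <= t.+1 <= i)%N by lia.
have siii : (s <= i <= i)%N by lia.
have isn : (i < n)%N by lia.
have clt := tower_local tw st1; have clt' := tower_local tw st2.
have lsdt := tower_lsd tw stn; have cPt := tower_coef tw stn.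
have sRt := tower_subring tw st2; have idt := tower_ideal tw st2.
have Rxt : Rs t.+1 (x t) := skew_mem_var clt cPt.
have mxt : ideal_pow (Rs t.+1) (m t.+1) 1 (x t).
  rewrite (ideal_pow1 sRt idt); apply/(skew_maximal_ideal clt clt' lsdt cPt).
  split=> //; rewrite -[x t]mul1r -[x t]expr1 (coef_monE cPt).
    by have [_ []] := tower_ideal tw st1.
  by have [] := tower_subring tw st1.
have [[[_ _ surj] _ _ _] _ _ _] := tower_triangular tw sti isn.
have [[[_ inj _] _ _ _] _ _ _] := tower_triangular tw siii isn.
have [_ sgN _] := tower_lsd tw sin.
(* Triangularity puts the preimage in [Rs t.+1], so [y] is a series in [x t] over [Rs t]. *)
have [y Ry ey] := surj _ Rxt.
have mixt : ideal_pow (Rs i) (m i) 1 (x t) by apply/(tower_ideal_pow tw _ sti (ltnW isn)).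
have my : ideal_pow (Rs t.+1) (m t.+1) 1 y.
  apply/(tower_ideal_pow tw _ sti (ltnW isn) Ry).
  (* [sigma i] maps [m i] onto itself, so [x t] has a preimage there, and injectivity on [Rs i]
     makes it equal to [y]. *)
  move: mixt; rewrite -{1}sgN => -[y' my' ey'].
  suff -> : y = y' by [].
  apply: inj; rewrite ?inE ?ey ?ey' //.
    by apply: (tower_sub tw _ _ Ry); lia.
  exact: (ideal_pow_sub (tower_subring tw si1) (tower_ideal tw si1) my').
have [_ mdl] := tower_pow_stable tw sti isn my.
pose b0 := coef t y 0; pose b1 := coef t y 1.
have Rb1 : Rs t b1 by apply: (coef_mem cPt).
have mb0 : ideal_pow (Rs t) (m t) 1 b0.
  by move: my; rewrite (skew_ideal_pow clt clt' lsdt cPt) => -[_ /(_ 0%N)].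
have [c mc] := tower_residue st1 Rb1.
pose w := (b1 - iota c) * x t + (y - skew_trunc (x t) (coef t) y 2).
have mw : ideal_pow (Rs t.+1) (m t.+1) 2 w.
  apply: (additive_subgroupD (ideal_pow_additive sRt idt 2)).
    apply: (ideal_powM sRt idt (M := 1) (N := 1)) => //.
    have Rbc := ideal_pow_sub (tower_subring tw st1) (tower_ideal tw st1) mc.
    have stt : (s <= t <= t.+1)%N by lia.
    have tn1 : (t.+1 <= n)%N by lia.
    exact/(tower_ideal_pow tw _ stt tn1 Rbc).
  exact: (skew_trunc_close clt clt' lsdt cPt 2 Ry).
have ye : y = iota c * x t + (b0 + w).
  rewrite /w /skew_trunc big_nat_recr //= big_nat1 expr0 expr1 mulr1 -/b0 -/b1.
  rewrite mulrBl opprD (addrA y) [b1 * x t - _ + _]addrC.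
  rewrite [y - b0 - _ + _]addrA subrK.
  rewrite [b0 + _]addrA [b0 + (y - b0)]addrC (subrK b0) [RHS]addrC.
  by rewrite (subrK (iota c * x t)).
have xtxi : x t * x i = iota c * (x i * x t) + (x i * b0 + (x i * w - dl i y)).
  have -> : x t * x i = x i * y - dl i y.
    rewrite xi_comm ?ey ?addrK //; by apply: (tower_sub tw _ _ Ry); lia.
  by rewrite {1}ye !mulrDr mulrA (centralizes_iota_var isn) -!addrA -mulrA.
exists c, (x i * b0 + (x i * w - dl i y)); split=> //.
have VVi : VV (fun l => (i < l)%N : nat) (x i) := multi_filtration_var isn.
have V2 r : ideal_pow (Rs t.+1) (m t.+1) 2 r -> forall l, (t < l <= n)%N -> V l n 2 r.
  exact: multi_filtration_ideal_pow.
have Vtriv l r : (s <= l)%N -> V l n 0 r by move=> sl; rewrite (filt0 (filtn sl)).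
(* The term with [b0] gains at [l = t], where [x t] has weight 0 and [m t] weight 1. The elements
   [w] and [dl i y] lie in the square of [m t.+1] and gain at [l = t.+1]. *)
apply: higher_termsD.
  have stl : (s <= t <= n)%N by [].
  apply: (higher_terms_single stl) => [l sl|].
    rewrite addnC; have [sl' _] := andP sl.
    apply: (filtM (filtn sl')); first exact: VVi.
    case: ltnP => tl; last exact: Vtriv.
    by apply: (multi_filtration_ideal_pow st1 mb0); lia.
  rewrite ltnn (ltnNge i t) (ltnW ti) /=; apply: (filtMl (filtn st)) => //.
  by apply: (multi_filtration_ideal_pow st1 mb0); lia.
have st' : (s <= t.+1)%N by lia.
apply: (higher_terms_single st2) => [l sl|]; have addV := filt_additive (filtn _).
  have [sl' _] := andP sl; have [tl|tl] := ltnP t l; last first.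
    have -> : (i < l)%N = false by lia.
    exact: Vtriv.
  have Vl := V2 _ _ l; have tln : (t < l <= n)%N by lia.
  have [_] := addV _ sl' (1 + (i < l))%N; apply.
    apply: (filt_le (filtn sl')) (filtMl (filtn sl') (Rn (x i)) (Vl _ mw tln)).
    by case: (i < l)%N.
  by apply: (filt_le (filtn sl')) (Vl _ mdl tln); case: (i < l)%N.
have -> : ((t < t.+1) + (i < t.+1))%N = 1%N by rewrite ltnSn ltnS leqNgt ti.
have tln : (t < t.+1 <= n)%N by lia.
have [_] := addV _ st' 2; apply; last exact: V2.
by apply: (filtMl (filtn st')) => //; exact: V2.
Qed.

(** [q] moves left past [r'], then past [r]; the scalar of the first move has to cross [r]. *)
Lemma scalar_eq_commMl f f' g r r' q : VV f r -> VV f' r' -> VV g q ->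
  centralizes_iota r ->
  scalar_eq (fun l => f l + g l)%N (r * q) (q * r) ->
  scalar_eq (fun l => f' l + g l)%N (r' * q) (q * r') ->
  scalar_eq (fun l => f l + f' l + g l)%N (r * r' * q) (q * (r * r')).
Proof.
move=> fr fr' gq cr e e'; apply: (@scalar_eq_trans _ _ (r * q * r')).
  rewrite -!mulrA; apply: eq_scalar_eq (scalar_eqMl fr cr e') => l /=.
  by rewrite addnA.
rewrite mulrA; apply: eq_scalar_eq (scalar_eqMr fr' e) => l /=.
by rewrite addnAC.
Qed.

Lemma scalar_eq_commMr f g g' r q q' : VV f r -> VV g q -> VV g' q' ->
  centralizes_iota q ->
  scalar_eq (fun l => f l + g l)%N (r * q) (q * r) ->
  scalar_eq (fun l => f l + g' l)%N (r * q') (q' * r) ->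
  scalar_eq (fun l => f l + (g l + g' l))%N (r * (q * q')) (q * q' * r).
Proof.
move=> fr gq gq' cq e e'; apply: (@scalar_eq_trans _ _ (q * r * q')).
  rewrite mulrA; apply: eq_scalar_eq (scalar_eqMr gq' e) => l /=.
  by rewrite addnA.
rewrite -!mulrA; apply: eq_scalar_eq (scalar_eqMl gq cq e') => l /=.
by rewrite addnCA.
Qed.

Lemma scalar_eq_one_comm f q : scalar_eq f (1 * q) (q * 1).
Proof. by rewrite mul1r mulr1; apply: scalar_eq_refl. Qed.

Lemma scalar_eq_mon_var t i b : (t <= i)%N -> (s <= i < n)%N ->
  scalar_eq (fun l => weight l t b + (i < l))%N (mon t b * x i) (x i * mon t b).
Proof.
move=> + sin; have isn : (i < n)%N by lia.
elim: t => [|t IH] ti.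
  by rewrite /ordered_monomial big_nil; apply: scalar_eq_one_comm.
have tn : (t < n)%N by lia.
have VVX j : VV (fun l => j * (t < l))%N (x t ^+ j).
  exact: (multi_filtrationX _ (multi_filtration_var tn)).
have powc j : scalar_eq (fun l => j * (t < l) + (i < l))%N
    (x t ^+ j * x i) (x i * x t ^+ j).
  elim: j => [|j IHj]; first exact: scalar_eq_one_comm.
  rewrite exprS; have := scalar_eq_commMl (multi_filtration_var tn) (VVX j)
    (multi_filtration_var isn) (centralizes_iota_var tn) (scalar_eq_vars ti sin) IHj.
  by apply: eq_scalar_eq => l /=; rewrite mulSn.
rewrite ordered_monomialS.
have := scalar_eq_commMl (multi_filtration_mon b (ltnW tn)) (VVX (b t))
  (multi_filtration_var isn) (centralizes_iota_mon b (ltnW tn)) (IH (ltnW ti)) (powc _).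
by apply: eq_scalar_eq => l /=; rewrite weightS [((t < l) * _)%N]mulnC.
Qed.

Lemma scalar_eq_mon_varX i b j : (s <= i < n)%N ->
  scalar_eq (fun l => weight l i b + j * (i < l))%N
    (mon i b * x i ^+ j) (x i ^+ j * mon i b).
Proof.
move=> sin; have isn : (i < n)%N by lia.
elim: j => [|j IH]; first by rewrite expr0 mulr1 mul1r; apply: scalar_eq_refl.
rewrite exprS; have := scalar_eq_commMr (multi_filtration_mon b (ltnW isn))
  (multi_filtration_var isn) (multi_filtrationX j (multi_filtration_var isn))
  (centralizes_iota_var isn) (scalar_eq_mon_var b (leqnn i) sin) IH.
by apply: eq_scalar_eq => l /=; rewrite mulSn.
Qed.

Lemma base_monomialD i a b : (i <= s)%N ->
  mon i (fun t => a t + b t)%N = mon i a * mon i b.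
Proof.
have ss : (s <= s <= n)%N by case/andP: snn => -> _; rewrite leqnn.
have sR := tower_subring tw ss; have [R1 _ RM] := sR.
elim: i => [|i IH] si; first by rewrite /ordered_monomial !big_nil mulr1.
have monR : Rs s (mon i b).
  rewrite /ordered_monomial big_nat; apply: big_ind => // t ti.
  by apply: subringX => //; apply: base_var_mem; lia.
rewrite !ordered_monomialS IH ?(ltnW si) // exprD -!mulrA; congr (_ * _).
rewrite !mulrA; congr (_ * _); apply: (base_comm bd) => //.
by apply: subringX => //; apply: base_var_mem.
Qed.

(** After the induction hypothesis has split the earlier variables, one move remains: [x i ^+ a i]
    goes left past [mon i b]. All errors are measured against the same total weight, so the
    relations compose. *)
Lemma scalar_eq_monD i a b : (s <= i <= n)%N ->
  scalar_eq (fun l => weight l i (fun t => a t + b t))%N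
    (mon i (fun t => a t + b t)%N) (mon i a * mon i b).
Proof.
move: i; apply: tower_ind => [|i sin IH].
  by rewrite base_monomialD //; apply: scalar_eq_refl.
have isn : (i < n)%N by lia.
have VVX j := multi_filtrationX j (multi_filtration_var isn).
have VVm c := multi_filtration_mon c (ltnW isn).
rewrite !ordered_monomialS exprD mulrA.
apply: (@scalar_eq_trans _ _ (mon i a * mon i b * x i ^+ a i * x i ^+ b i)).
  apply: eq_scalar_eq (scalar_eqMr (VVX (b i)) (scalar_eqMr (VVX (a i)) IH)) => l.
  by rewrite /= weightS mulnDr addnA ![((i < l) * _)%N]mulnC.
rewrite !mulrA; have := scalar_eqMr (VVX (b i))
  (scalar_eqMl (VVm a) (centralizes_iota_mon a (ltnW isn))
     (scalar_eq_mon_varX b (a i) sin)).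
rewrite !mulrA; apply: eq_scalar_eq => l.
by rewrite /= weightS weightD mulnDr !addnA ![((i < l) * _)%N]mulnC.
Qed.

(** The product lies in the filtration at the sum of the weights, so its digits of smaller
    [l]-weight agree with those of 0. *)
Lemma digit_monomialM_weight a b c l : (s <= l <= n)%N -> C n 0 c = 0 ->
  C n (mon n a * mon n b) c != 0 ->
  (weight l n a + weight l n b <= weight l n c)%N.
Proof.
move=> sl C0 nz; rewrite leqNgt; apply: contra_neqN nz => wlt.
have [sl' _] := andP sl.
set r := _ * _; have := digit_cong tw bd sl' snn
  (weight l n a + weight l n b) (Rn r) (Rn 0).
rewrite subr0 -C0 => -[+ _]; apply => //.
exact: (multi_filtrationM (multi_filtration_mon _ (leqnn n))
  (multi_filtration_mon _ (leqnn n))).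
Qed.

End LeadingTerms.

(** * Dominance and leading monomials *)

Section Dominance.
Variable n : nat.
Implicit Types alpha beta : 'rV[nat]_n.

Definition partial_degree alpha l := \sum_(0 <= t < l) exponent alpha t.
Local Notation W := partial_degree.

Lemma weight_exponent alpha l : (l <= n)%N -> weight l n (exponent alpha) = W alpha l.
Proof.
move=> ln; rewrite /weight /W (big_cat_nat (leq0n l) ln) /=.
rewrite [X in (_ + X)%N]big_nat [X in (_ + X)%N]big1 ?addn0; last first.
  by move=> t /andP[lt _]; rewrite ltnNge lt.
by apply: eq_big_nat => t /andP[_ tl]; rewrite tl mul1n.
Qed.

Lemma partial_degreeS alpha l : W alpha l.+1 = (W alpha l + exponent alpha l)%N.
Proof. by rewrite /W big_nat_recr. Qed.

Lemma shuffle_sum (I : eqType) (t : seq I) (f : I -> 'rV[int]_n) :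
  (forall i, i \in t -> shuffle (f i)) -> shuffle (\sum_(i <- t) f i).
Proof.
elim: t => [|i t IH] sf; first by exists [::]; rewrite ?big_nil.
have [u uE ei] : shuffle (f i) by apply: sf; rewrite inE eqxx.
have [v vE et] : shuffle (\sum_(i <- t) f i).
  by apply: IH => j jt; apply: sf; rewrite inE jt orbT.
exists (u ++ v); last by rewrite big_cons big_cat ei et.
by move=> z; rewrite mem_cat => /orP[/uE|/vE].
Qed.

(* Abel summation: if [v] has partial sums [d_l >= 0] and total sum [0] then
   [v] is the sum over [l] of [d_l] copies of [e_l - e_(l+1)]. *)
Lemma dominance_shuffle alpha beta :
  (forall l, (l <= n)%N -> (W alpha l <= W beta l)%N) -> W alpha n = W beta n ->
  shuffle (to_int beta - to_int alpha).
Proof.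
move=> dom eqn; pose D l := (W beta l - W alpha l)%N.
(* The default 0 gives [b n] a meaning; the term [l.+1 = n] of the sum below vanishes because
   [D n = 0]. *)
pose b (t : nat) : 'rV[int]_n :=
  if insub t is Some i then basis_vector i else 0.
have bE t (i : 'I_n) : b t 0 i = if t == i then 1 else 0.
  rewrite /b; case: insubP => [j _ <-|nt]; rewrite !mxE.
    by rewrite eqxx /= -val_eqE eq_sym; case: (_ == _).
  by case: eqP => // e; rewrite e ltn_ord in nt.
have -> : to_int beta - to_int alpha =
    \sum_(0 <= l < n) (b l - b l.+1) *+ D l.+1.
  apply/rowP => i; rewrite summxE !mxE -!exponent_ord.
  transitivity ((D i.+1)%:Z - (D i)%:Z).
    have := dom i (ltnW (ltn_ord i)); have := dom i.+1 (ltn_ord i).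
    by rewrite /D !partial_degreeS; lia.
  under eq_bigr => l _ do rewrite mulmxnE !mxE !bE mulrnBl.
  rewrite sumrB; congr (_ - _).
    transitivity (\sum_(0 <= l < n) if l == i then (D i.+1)%:Z else 0).
      by rewrite -big_mkcond big_nat1_eq /= ltn_ord.
    apply: eq_bigr => l _; case: eqP => [->|_]; last by rewrite mul0rn.
    by rewrite -mulr_natr mul1r natz.
  case: (val i) (ltn_ord i) => [|j] jn /=.
    rewrite big1 => [|l _]; last by rewrite mul0rn.
    by rewrite /D /W !big_nil.
  transitivity (\sum_(0 <= l < n) if l == j then (D j.+1)%:Z else 0).
    by rewrite -big_mkcond big_nat1_eq /= (ltnW jn).
  apply: eq_bigr => l _; rewrite eqSS; case: eqP => [->|_]; last by rewrite mul0rn.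
  by rewrite -mulr_natr mul1r natz.
apply: shuffle_sum => l; rewrite mem_index_iota => /andP[_ ln].
have [ln1|nl] := ltnP l.+1 n; last first.
  have -> : l.+1 = n by lia.
  by exists [::]; rewrite // big_nil /D eqn subnn mulr0n.
exists (nseq (D l.+1) (b l - b l.+1)).
  move=> u /nseqP[-> _]; exists (Ordinal ln), (Ordinal ln1); split=> //=.
  by rewrite /b !insubT.
by rewrite big_nseq; elim: (D _) => [|j IH] //=; rewrite mulrS IH.
Qed.

(** Cutting [beta] from the right down to the total degree [T] of [alpha] gives [beta'], with
    partial degrees capped at [T]. It still dominates [alpha], now with equal total, so it differs
    from [alpha] by a shuffle, and it is at most [beta] entrywise. *)
Lemma dominance_le_F alpha beta :
  (forall l, (l <= n)%N -> (W alpha l <= W beta l)%N) -> le_F alpha beta.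
Proof.
move=> dom; pose T := W alpha n.
pose beta' : 'rV[nat]_n := \row_i (minn (W beta i.+1) T - minn (W beta i) T)%N.
have W' l : (l <= n)%N -> W beta' l = minn (W beta l) T.
  elim: l => [|l IH] ln; first by rewrite /W !big_nil min0n.
  rewrite partial_degreeS IH ?(ltnW ln) //.
  rewrite -[X in exponent _ X]/(val (Ordinal ln)) exponent_ord mxE /=.
  by rewrite partial_degreeS; lia.
exists beta'.
  exists (to_int beta' - to_int alpha); last by rewrite addrC subrK.
  apply: dominance_shuffle => [l ln|].
    rewrite W' // leq_min dom //= /T -(subnKC ln).
    elim: (n - l)%N => [|j IH]; first by rewrite addn0.
    by rewrite addnS partial_degreeS (leq_trans IH) ?leq_addr.
  by rewrite W' //; apply/esym/minn_idPr/dom.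
have beta'_le i : (beta' 0%R i <= beta 0%R i)%N.
  by rewrite mxE partial_degreeS exponent_ord; lia.
exists (\row_i (beta 0%R i - beta' 0%R i)%N) => //.
apply/rowP => i; rewrite [LHS]mxE [X in _ + X]mxE.
exact: subnKC (beta'_le i).
Qed.

End Dominance.

Section LeadingMonomial.
Variables (R : nzRingType) (k : finFieldType) (n s : nat) (Rs m : nat -> set R).
Variables (x : nat -> R) (sg dl : nat -> R -> R) (coef : nat -> R -> nat -> R).
Variables (iota : k -> R) (dg : R -> (nat -> nat) -> k) (y : 'I_n -> R).
Variable le : rel 'rV[nat]_n.
Hypothesis tw : skew_tower n s Rs m x sg dl coef.
Hypothesis bd : base_digits n s Rs m x iota dg.
Hypothesis xy : forall i : 'I_n, x i = y i.
Hypotheses (s1 : (s <= 1)%N) (triangular_le : triangular_order le).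

Local Notation C := (digit s coef dg).

Lemma tower_is_LM alpha beta :
  is_LM Rs m y iota le (monomial y alpha * monomial y beta) (alpha + beta).
Proof.
have sn := tower_le tw; have snn : (s <= n <= n)%N by rewrite sn leqnn.
have C0 gamma := digit0 tw bd xy gamma.
have expD : exponent (alpha + beta) = fun t => (exponent alpha t + exponent beta t)%N.
  by apply/funext => t; rewrite exponentD.
have nz : C n (monomial y alpha * monomial y beta) (exponent (alpha + beta)) != 0.
  have [c [v [hv e]]] := scalar_eq_monD tw bd (exponent alpha) (exponent beta) snn.
  have := digit_monomial tw bd xy (alpha + beta).
  rewrite !(monomialE xy) {1}expD e (digit_higher_terms tw bd _ hv); last first.
    by move=> l _; rewrite expD.
  rewrite (digit_scale tw bd xy) => cC; apply/eqP => C1.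
  by move: cC; rewrite C1 mulr0 => /esym/eqP; rewrite oner_eq0.
split.
- by apply: contra_neq nz => ->; apply: C0.
- exact/(suppP tw bd xy).
- move=> gamma /(suppP tw bd xy) Cg; apply/triangular_le/dominance_le_F => l ln.
  (* The filtrations are available for [l >= s]; as [s <= 1], only [l = 0] needs separate treatment,
     and there both partial degrees are 0. *)
  have [->|l0] := posnP l; first by rewrite /partial_degree !big_nil.
  have sl : (s <= l <= n)%N by lia.
  rewrite -!weight_exponent // expD weightD.
  by apply: (digit_monomialM_weight tw bd sl (C0 gamma)); rewrite -!(monomialE xy).
Qed.

End LeadingMonomial.

(** * The two base rings *)

Definition nat_indexed (n : nat) (T : Type) (d : T) (f : 'I_n -> T) (t : nat) : T :=
  if insub t is Some i then f i else d.

Lemma nat_indexed_ord (n : nat) (T : Type) (d : T) (f : 'I_n -> T) (i : 'I_n) :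
  nat_indexed d f i = f i.
Proof. by rewrite /nat_indexed valK. Qed.

Lemma triangular_tower_skew (n s : nat) (R : nzRingType) (Rs m : nat -> set R)
    (x : 'I_n -> R) (sigma delta : 'I_n -> R -> R) :
  (s <= n)%N -> triangular_tower Rs m x sigma delta s ->
  exists coef, skew_tower n s Rs m (nat_indexed 0 x)
    (nat_indexed id sigma) (nat_indexed id delta) coef.
Proof.
move=> sn [Rn cl step].
have ord (P : nat -> Prop) : (forall i : 'I_n, (s <= i)%N -> P i) ->
    forall i, (s <= i < n)%N -> P i.
  by move=> HP i /andP[si ni]; apply: (HP (Ordinal ni)).
have /choice[coef coefE] : forall i, exists c, (s <= i < n)%N ->
    skew_coefficients (Rs i) (m i) (Rs i.+1) (nat_indexed 0 x i)
      (nat_indexed id sigma i) (nat_indexed id delta i) c.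
  move=> i; have [sin|nsin] := boolP (s <= i < n)%N; last by exists (fun r _ => r).
  move: i sin; apply: ord => i si; have [_ _ _ [_ [c cP]]] := step i si.
  by exists c => _; rewrite !nat_indexed_ord.
exists coef; split=> //.
- by apply: ord => i si; have [lsd _ _ _] := step i si; rewrite !nat_indexed_ord.
- by apply: ord => i si; have [_ lin _ _] := step i si; rewrite !nat_indexed_ord.
- move=> i j sji ni; have /andP[sj ji] := sji.
  have [_ _ tri _] := step (Ordinal ni) (leq_trans sj ji).
  by have := tri j sji; rewrite -!(nat_indexed_ord id).
Qed.

(** * Base ring of type A: a finite field *)

Section FieldBase.
Variables (R : nzRingType) (k : finFieldType) (n : nat) (Rs m : nat -> set R).
Variables (x : nat -> R) (phi : {rmorphism k -> R}) (iota : k -> R).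
Hypotheses (locR : local_ring (Rs 0) (m 0)) (R0 : Rs 0 = range phi).
Hypothesis iotaE : iota =1 phi.

Let phi_mem c : range phi (phi c). Proof. by exists c. Qed.

Lemma field_base_ideal : m 0 = [set 0].
Proof.
have [_ _ uniq] := locR; apply/esym/uniq; rewrite R0; split.
- split.
  + by move=> _ ->; rewrite -(rmorph0 phi).
  + by [].
  + by move=> _ _ -> ->; rewrite addr0.
  + by move=> b _ _ ->; rewrite mulr0.
- move=> e; have : range phi 1 by rewrite -(rmorph1 phi).
  by rewrite -e => /eqP; rewrite oner_eq0.
- move=> J [JR J0 JD JM] _; have [[a [Ja a0]]|nex] := pselect (exists a, J a /\ a != 0).
    right; apply/seteqP; split=> // _ [b _ <-].
    have [c _ ca] := JR _ Ja.
    have c0 : c != 0 by apply: contra_neq a0 => c0; rewrite -ca c0 rmorph0.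
    have -> : phi b = phi (b / c) * a by rewrite -ca -rmorphM divfK.
    exact: JM.
  left; apply/seteqP; split=> a; last by move=> ->.
  by move=> Ja; apply/eqP; apply: contra_notT nex => a0; exists a.
Qed.

Lemma field_base_digits : exists dg, base_digits n 0 Rs m x iota dg.
Proof.
have /choice[f fP] : forall r, exists c, Rs 0 r -> phi c = r.
  move=> r; rewrite R0; have [[c _ <-]|nr] := pselect (range phi r).
    by exists c.
  by exists 0.
have phi_mem0 c : Rs 0 (phi c) by rewrite R0.
have fK : cancel phi f by move=> c; apply: (fmorph_inj phi); rewrite fP.
(* With [s = 0] there is no base variable: an element has a single digit, its preimage under
   [phi]. *)
exists (fun r _ => f r); split.
- by rewrite iotaE rmorph0.
- by rewrite iotaE rmorph1.
- by move=> a b; rewrite !iotaE rmorphM.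
- by move=> a b; rewrite !iotaE => /fmorph_inj.
- by move=> c; rewrite iotaE.
- by rewrite R0 => _ _ [a _ <-] [b _ <-]; rewrite -!rmorphM mulrC.
- by [].
- have [sR _ _] := locR; have addR := subring_additive sR.
  move=> d r r' Rr Rr'; case: d => [|d].
    split=> [_ a|_]; first by [].
    by have [_] := addR; apply.
  have powE q : ideal_pow (Rs 0) (m 0) d.+1 q <-> q = 0.
    split=> [|->]; last first.
      by have [] := ideal_pow_additive sR (local_two_sided locR) d.+1.
    apply: (@ideal_mul_ind _ _ _ [set 0]).
      by split=> // _ _ -> ->; rewrite subr0.
    by rewrite field_base_ideal => _ b -> _ /=; rewrite mul0r.
  rewrite powE; split=> [/eqP|H]; first by rewrite subr_eq0 => /eqP->.
  by rewrite -(fP r) // -(fP r') // (H (fun=> 0%N)) ?subrr // big_nil.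
- by [].
- move=> D c gamma uD eD.
  (* The agreement required from [s = 0] on leaves only [gamma] itself, so [uniq D] bounds the sum
     to one term. *)
  have D1 alpha : alpha \in D -> alpha = gamma.
    by move=> /eD e; apply: exponent_inj => t _; apply: e.
  case: D uD D1 {eD} => [|a [|b D]] uD D1.
  + by rewrite big_nil -(rmorph0 phi) fK.
  + rewrite big_seq1 /ordered_monomial big_nil mulr1 iotaE fK (D1 a) ?inE ?eqxx //.
  + have ea : a = gamma by apply: D1; rewrite inE eqxx.
    have eb : b = gamma by apply: D1; rewrite !inE eqxx orbT.
    by move: uD; rewrite ea eb cons_uniq inE eqxx.
Qed.

End FieldBase.

(** * Base ring of type B: digits with respect to a uniformiser *)

Section ValuationDigits.
Variables (A : idomainType) (k : finFieldType) (pi : {rmorphism A -> k}).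
Variables (tau : k -> A) (w : A) (q : A -> A).
Hypotheses (tauK : cancel tau pi) (tauM : {morph tau : a b / a * b}).
Hypotheses (w0 : w != 0) (piw : pi w = 0).
Hypothesis qE : forall a, a = tau (pi a) + w * q a.

Lemma multiplicative_section1 : tau 1 = 1.
Proof.
have t1 : tau 1 != 0.
  by apply/eqP => t0; have := tauK 1; rewrite t0 rmorph0 => /esym/eqP; rewrite oner_eq0.
by apply: (mulfI t1); rewrite -tauM !mulr1.
Qed.

(** [tau 0] is idempotent in a domain; were it 1, it would equal [tau 1], against injectivity of
    [tau]. *)
Lemma multiplicative_section0 : tau 0 = 0.
Proof.
apply/eqP; apply: contraT => t0.
have : tau 0 = 1 by apply: (mulfI t0); rewrite -tauM !mulr1 mul0r.
by rewrite -multiplicative_section1 => /(can_inj tauK)/esym/eqP; rewrite oner_eq0.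
Qed.

(** Teichmueller digits, obtained by iterating [a = tau (pi a) + w * q a]. *)
Fixpoint valuation_digit (a : A) (j : nat) : k :=
  if j is j'.+1 then valuation_digit (q a) j' else pi a.

Lemma residue_quotient c a : pi (tau c + w * a) = c /\ q (tau c + w * a) = a.
Proof.
have piE : pi (tau c + w * a) = c.
  by rewrite rmorphD rmorphM piw mul0r addr0 tauK.
split=> //; have := qE (tau c + w * a); rewrite piE => /addrI/(mulfI w0).
by move=> <-.
Qed.

Lemma valuation_digit_cong d a b :
  (exists z, a - b = w ^+ d * z) <->
  forall j, (j < d)%N -> valuation_digit a j = valuation_digit b j.
Proof.
elim: d a b => [|d IH] a b.
  by split=> // _; exists (a - b); rewrite mul1r.
split=> [[z e]|H].
  have piab : pi a = pi b.
    apply/eqP; rewrite -subr_eq0 -rmorphB e exprS -mulrA rmorphM piw mul0r.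
    exact: eqxx.
  case=> [|j] jd //=; apply: (IH _ _).1 => //; exists z.
  apply: (mulfI w0); rewrite mulrA -exprS -e {2}(qE a) {2}(qE b) piab.
  by rewrite opprD addrACA subrr add0r mulrBr.
have [z e] : exists z, q a - q b = w ^+ d * z.
  by apply/IH => j jd; apply: (H j.+1).
exists z; have /= piab := H 0%N isT.
rewrite {1}(qE a) {1}(qE b) piab.
by rewrite opprD addrACA subrr add0r -mulrBr e exprS mulrA.
Qed.

Lemma valuation_digit_sum M (c : nat -> k) j : (j < M)%N ->
  valuation_digit (\sum_(0 <= t < M) tau (c t) * w ^+ t) j = c j.
Proof.
elim: M c j => [//|M IH] c j jM.
rewrite big_nat_recl // expr0 mulr1.
under eq_bigr => t _ do rewrite exprS mulrCA.
rewrite -mulr_sumr.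
have [pE qE'] := residue_quotient (c 0%N) (\sum_(0 <= t < M) tau (c t.+1) * w ^+ t).
case: j jM => [|j] jM /=; first exact: pE.
by rewrite qE'; apply: (IH (fun t => c t.+1)).
Qed.

(** The exponents are completed to an initial interval by zero digits, which contribute nothing
    because [tau 0 = 0]. *)
Lemma valuation_digit_seq (D : seq nat) (c : nat -> k) j : uniq D ->
  valuation_digit (\sum_(t <- D) tau (c t) * w ^+ t) j = if j \in D then c j else 0.
Proof.
move=> uD; pose M := (maxn j (\max_(t <- D) t)).+1.
pose c' t := if t \in D then c t else 0.
have -> : \sum_(t <- D) tau (c t) * w ^+ t = \sum_(0 <= t < M) tau (c' t) * w ^+ t.
  rewrite [RHS](bigID (mem D)) /= [X in _ = _ + X]big1 ?addr0; last first.
    by move=> t tD; rewrite /c' ifN ?multiplicative_section0 ?mul0r.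
  have pD : perm_eq D [seq t <- index_iota 0 M | t \in D].
    apply: uniq_perm => //; first exact: filter_uniq (iota_uniq _ _).
    move=> t; rewrite mem_filter mem_index_iota /=; case: (boolP (t \in D)) => //= tD.
    by rewrite ltnS leq_max (leq_bigmax_seq (P := predT) (F := fun t => t)) ?orbT.
  rewrite -[RHS]big_filter (perm_big _ pD) big_seq [RHS]big_seq.
  by apply: eq_bigr => t; rewrite mem_filter /c' => /andP[-> _].
by rewrite valuation_digit_sum // ltnS leq_maxl.
Qed.

End ValuationDigits.

Section ValuationBase.
Variables (A : idomainType) (k : finFieldType) (mA : set A).
Variables (R : nzRingType) (n : nat) (Rs m : nat -> set R) (x : nat -> R).
Variables (phi : {rmorphism A -> R}) (pi : {rmorphism A -> k}).
Variables (tau : k -> A) (w : A) (iota : k -> R).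
Hypotheses (dvrA : complete_dvr mA) (mAE : mA = [set a | pi a = 0]).
Hypothesis mAw : mA = range (fun a => a * w).
Hypotheses (tauK : cancel tau pi) (tauM : {morph tau : a b / a * b}).
Hypotheses (iotaE : iota =1 phi \o tau) (phi_inj : injective phi).
Hypotheses (locR : local_ring (Rs 1) (m 1)) (R1 : Rs 1 = range phi).
Hypothesis xw : x 0 = phi w.

Let phi_mem a : Rs 1 (phi a). Proof. by rewrite R1; exists a. Qed.

Let maxA : maximal_left_ideal setT mA.
Proof. by case: dvrA => _ _ [[]]. Qed.

Lemma uniformizer_residue : pi w = 0.
Proof.
have : mA w by rewrite mAw; exists 1; rewrite ?mul1r.
by rewrite mAE.
Qed.

(** If [w = 0] then [mA] is zero, so by maximality every nonzero principal ideal is the whole ring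
    and [A] is a field. *)
Lemma uniformizer_neq0 : w != 0.
Proof.
case: dvrA => _ nfield _; apply/eqP => w0; apply: nfield => a a0.
have mA0 b : mA b -> b = 0 by rewrite mAw => -[c _ <-]; rewrite w0 mulr0.
have [_ _ maxJ] := maxA.
have lJ : left_ideal setT (range (fun b => b * a)).
  split=> //; first by exists 0; rewrite // mul0r.
    by move=> _ _ [b _ <-] [c _ <-]; exists (b + c); rewrite // mulrDl.
  by move=> b _ _ [c _ <-]; exists (b * c); rewrite // mulrA.
have [|eJ|eJ] := maxJ _ lJ.
- by move=> b /mA0->; exists 0; rewrite // mul0r.
- have : mA a by rewrite -eJ; exists 1; rewrite // mul1r.
  by move/mA0/eqP; rewrite (negPf a0).
- have : range (fun b => b * a) 1 by rewrite eJ.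
  by case=> b _ ba; apply/unitrP; exists b; rewrite [a * b]mulrC.
Qed.

Lemma valuation_base_ideal : m 1 = phi @` mA.
Proof.
have [_ _ uniq] := locR; have [[_ mA0 mAD mAM] mAneq mAmax] := maxA.
apply/esym/uniq; rewrite R1; split.
- split.
  + by move=> _ [a _ <-]; exists a.
  + by exists 0; rewrite ?rmorph0.
  + by move=> _ _ [a ma <-] [b mb <-]; exists (a + b); rewrite ?rmorphD //; exact: mAD.
  + by move=> _ _ [b _ <-] [a ma <-]; exists (b * a); rewrite ?rmorphM //; exact: mAM.
- move=> e; have : range phi 1 by exists 1; rewrite ?rmorph1.
  rewrite -e => -[a ma]; rewrite -(rmorph1 phi) => /phi_inj a1.
  by move: ma; rewrite mAE /= a1 rmorph1 => /eqP; rewrite oner_eq0.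
- move=> J [JR J0 JD JM] mJ.
  have lJ : left_ideal setT (phi @^-1` J).
    split=> //=; first by rewrite rmorph0.
      by move=> a b Ja Jb; rewrite rmorphD; apply: JD.
    by move=> b a _ Ja; rewrite rmorphM; apply: JM => //; exists b.
  have eJ : J = phi @` (phi @^-1` J).
    apply/seteqP; split=> [r Jr|_ [a Ja <-] //].
    by have [a _ ar] := JR _ Jr; exists a; rewrite /= ?ar.
  have [|e|e] := mAmax _ lJ; last by right; rewrite eJ e.
    by move=> a ma; apply: mJ; exists a.
  by left; rewrite eJ e.
Qed.

Lemma valuation_base_pow d a :
  ideal_pow (Rs 1) (m 1) d (phi a) <-> exists z, a = w ^+ d * z.
Proof.
have [sR _ _] := locR; have idR := local_two_sided locR.
have mphi b : m 1 (phi (b * w)).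
  by rewrite valuation_base_ideal; exists (b * w) => //; rewrite mAw; exists b.
split=> [|[z ->]]; last first.
  rewrite mulrC rmorphM rmorphXn /=.
  apply: (ideal_powM sR idR (M := 0) (N := d)); first exact: phi_mem.
  by apply: ideal_powX => //; have := mphi 1; rewrite mul1r.
move=> pa; suff [z /phi_inj] : exists z, phi a = phi (w ^+ d * z) by exists z.
elim: d (phi a) pa => [|d IH] r.
  by rewrite R1 => -[b _ <-]; exists b; rewrite mul1r.
apply: (@ideal_mul_ind _ _ _ [set r | exists z, r = phi (w ^+ d.+1 * z)]).
  split=> [|_ _ [a1 ->] [a2 ->]]; first by exists 0; rewrite mulr0 rmorph0.
  by exists (a1 - a2); rewrite mulrBr rmorphB.
move=> b c mb pc; have [z ->] := IH _ pc; move: mb.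
rewrite valuation_base_ideal mAw => -[_ [a' _ <-] <-].
exists (a' * z); rewrite -rmorphM exprS; congr (phi _).
by rewrite -!mulrA mulrCA; congr (_ * _); rewrite mulrCA.
Qed.

Lemma valuation_base_digits : exists dg, base_digits n 1 Rs m x iota dg.
Proof.
have piw := uniformizer_residue; have w0 := uniformizer_neq0.
have /choice[q qE] : forall a, exists b, a = tau (pi a) + w * b.
  move=> a; have : mA (a - tau (pi a)) by rewrite mAE /= rmorphB tauK subrr.
  by rewrite mAw => -[b _ e]; exists b; rewrite [w * b]mulrC e addrC subrK.
have /choice[f fP] : forall r, exists a, Rs 1 r -> phi a = r.
  move=> r; rewrite R1; have [[a _ <-]|nr] := pselect (range phi r).
    by exists a.
  by exists 0.
have fK : cancel phi f by move=> a; apply: phi_inj; rewrite fP.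
exists (fun r a => valuation_digit pi q (f r) (a 0%N)); split.
- by rewrite iotaE /= (multiplicative_section0 tauK tauM) rmorph0.
- by rewrite iotaE /= (multiplicative_section1 tauK tauM) rmorph1.
- by move=> a b; rewrite !iotaE /= tauM rmorphM.
- by move=> a b; rewrite !iotaE => /phi_inj/(can_inj tauK).
- by move=> c; rewrite iotaE; exact: phi_mem.
- by rewrite R1 => _ _ [a _ <-] [b _ <-]; rewrite -!rmorphM mulrC.
- move=> [|//] _; rewrite xw valuation_base_ideal; exists w => //.
  by rewrite mAE.
- move=> d r r' Rr Rr'.
  rewrite -{1}(fP r Rr) -{1}(fP r' Rr') -rmorphB valuation_base_pow.
  rewrite (valuation_digit_cong w0 piw qE); split=> H j; first by rewrite big_nat1 => /H.
  by move=> jd; apply: (H (fun=> j)); rewrite big_nat1.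
- by move=> r a a' e; rewrite e.
- move=> D c gamma uD eD.
  (* Vectors of [D] differ from [gamma] at most in entry 0, so [upd] inverts the map taking [alpha]
     to that entry and turns the sum into one over powers of [w]. *)
  pose upd j : 'rV[nat]_n := \row_i if i == 0%N :> nat then j else gamma 0 i.
  have updE alpha : (forall t, (1 <= t)%N -> exponent alpha t = exponent gamma t) ->
      upd (exponent alpha 0) = alpha.
    move=> e; apply/rowP => i; rewrite mxE -!exponent_ord.
    by case: (val i) => [|t] //=; rewrite e.
  have updD alpha : alpha \in D -> upd (exponent alpha 0) = alpha.
    by move/eD/updE.
  have -> : \sum_(alpha <- D) iota (c alpha) * ordered_monomial x 1 (exponent alpha)
      = phi (\sum_(j <- [seq exponent alpha 0 | alpha <- D]) tau (c (upd j)) * w ^+ j).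
    rewrite big_map rmorph_sum big_seq [RHS]big_seq; apply: eq_bigr => alpha aD.
    by rewrite /ordered_monomial big_nat1 xw iotaE updD // rmorphM rmorphXn.
  rewrite fK (valuation_digit_seq tauK tauM w0 piw qE); last first.
    rewrite map_inj_in_uniq // => alpha beta aD bD e.
    by rewrite -(updD _ aD) e updD.
  rewrite (updE gamma) //; congr (if _ then _ else _).
  apply/mapP/idP => [[alpha aD e]|gD].
    by rewrite -(updE gamma) // e updD.
  by exists gamma.
Qed.

End ValuationBase.

Theorem theorem4p10 (n p : nat) (R : nzRingType) (k : finFieldType)
    (Rs m : nat -> set R) (x : 'I_n -> R) (sigma delta : 'I_n -> R -> R)
    (iota : k -> R) (le : rel 'rV[nat]_n) :
  type_A Rs m x sigma delta iota p \/ type_B Rs m x sigma delta iota p ->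
  additive_total_order le -> triangular_order le ->
  (forall alpha beta : 'rV[nat]_n,
     is_LM Rs m x iota le (monomial x alpha * monomial x beta) (alpha + beta)) /\
  monomial_order Rs m x iota le.
Proof.
move=> typeR orderle trile.
suff LM alpha beta :
    is_LM Rs m x iota le (monomial x alpha * monomial x beta) (alpha + beta).
  by split=> //; split.
have [s [s1 [coef [dg [tw bd]]]]] : exists s, (s <= 1)%N /\ exists coef dg,
    skew_tower n s Rs m (nat_indexed 0 x) (nat_indexed id sigma)
      (nat_indexed id delta) coef /\
    base_digits n s Rs m (nat_indexed 0 x) iota dg.
  case: typeR => [[_ [phi [R0 iotaE tri]]]|[_ n0 [A [mA [phi [pi [tau [w]]]]]]]].
    exists 0%N; split=> //; have [coef tw] := triangular_tower_skew (leq0n n) tri.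
    have [loc0 _ _] := tower_local tw (leq0n n).
    have [dg bd] := field_base_digits n (nat_indexed 0 x) loc0 R0 iotaE.
    by exists coef, dg.
  move=> [[dvrA _ mAE mAw] [[tauK tauM iotaE] [phi_inj R1 xw tri]]].
  exists 1%N; split=> //; have [coef tw] := triangular_tower_skew n0 tri.
  have [loc1 _ _] := tower_local tw (i := 1) n0.
  have xw0 : nat_indexed 0 x 0 = phi w.
    by rewrite -[0%N]/(val (Ordinal n0)) nat_indexed_ord xw.
  have [dg bd] := valuation_base_digits n dvrA mAE mAw tauK tauM iotaE phi_inj
    loc1 R1 xw0.
  by exists coef, dg.
exact: (tower_is_LM tw bd (nat_indexed_ord 0 x) s1 trile).
Qed.
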